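(* Let $k\ge 3$ and let $P_k$ be the path with $k$ edges. There is an algorithm which, given a hypergraph $\mathcal{H}$ with $n$ vertices and $m$ hyperedges, all of size $2$ or $3$, containing no Berge copy of $P_k$, outputs a strong coloring of $\mathcal{H}$ with at most $k$ colors in time $O(n+m)$.
   Context: A hypergraph contains a Berge copy of a graph $T$ if there are distinct hyperedges $f(e)$, $e\in E(T)$, and an injective map $\varphi:V(T)\to V(\mathcal{H})$ with $\{\varphi(x),\varphi(y)\}\subseteq f(xy)$ for every $xy\in E(T)$. A strong coloring is a vertex coloring in which every hyperedge is rainbow (its vertices receive pairwise distinct colors). *)

(* Defs.v *)
From mathcomp Require Import all_boot.
Set Implicit Arguments.
Unset Strict Implicit.
Unset Printing Implicit Defensive.

Record sgraph := SGraph {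
  vertex :> finType;
  adj : rel vertex;
  adj_sym : symmetric adj;
  adj_irr : irreflexive adj
}.

Definition edges (T : sgraph) : {set {set T}} :=
  [set [set p.1; p.2] | p : T * T & adj p.1 p.2].

Definition path_adj (k : nat) : rel 'I_k.+1 :=
  fun i j => (i.+1 == j :> nat) || (j.+1 == i :> nat).

Lemma path_adj_sym k : symmetric (@path_adj k).
Proof. by move=> i j; rewrite /path_adj orbC. Qed.

Lemma path_adj_irr k : irreflexive (@path_adj k).
Proof. by move=> i; rewrite /path_adj orbb; apply/negbTE; rewrite gtn_eqF. Qed.

(* The path with [k] edges, hence on the [k.+1] vertices 0, ..., k. *)
Definition path_graph (k : nat) : sgraph :=
  SGraph (@path_adj_sym k) (@path_adj_irr k).

Definition contains_berge (V : finType) (H : {set {set V}}) (T : sgraph) : Prop :=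
  exists (f : {set T} -> {set V}) (phi : T -> V),
    [/\ {in edges T, forall e, f e \in H},
        {in edges T &, injective f},
        injective phi
      & forall x y : T, adj x y -> [set phi x; phi y] \subset f [set x; y]].

Definition strong_coloring (V : finType) (C : eqType)
    (H : {set {set V}}) (c : V -> C) : Prop :=
  forall e, e \in H -> {in e &, injective c}.

Definition num_colors (V : finType) (C : eqType) (c : V -> C) : nat :=
  size (undup (codom c)).

(* Imperative programs over natural-number variables and arrays.  A program
   mentions only finitely many variables and arrays, so interleaving them in one
   memory gives a random access machine with constant-factor overhead. *)

Inductive expr :=
  | Const of nat
  | Var of nat
  | Add of nat & nat
  | Sub of nat & nat
  | Read of nat & nat.    (* [Read a x] is a[x]; the operands [x], [y] are variables *)

Inductive test := Lt of nat & nat | Eq of nat & nat.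

Inductive cmd :=
  | Skip
  | Assign of nat & expr
  | Store of nat & nat & nat   (* [Store a x y] is a[x] := y *)
  | Seq of cmd & cmd
  | If of test & cmd & cmd
  | While of test & cmd.

Record state := State { var : nat -> nat; arr : nat -> nat -> nat }.

Definition eval (s : state) (e : expr) : nat :=
  match e with
  | Const c => c
  | Var x => var s x
  | Add x y => var s x + var s y
  | Sub x y => var s x - var s y
  | Read a x => arr s a (var s x)
  end.

Definition holds (s : state) (b : test) : bool :=
  match b with
  | Lt x y => var s x < var s y
  | Eq x y => var s x == var s y
  end.

Definition set_var (s : state) (x v : nat) : state :=
  State (fun y => if y == x then v else var s y) (arr s).

Definition set_arr (s : state) (a i v : nat) : state :=
  State (var s)
    (fun b j => if (b == a) && (j == i) then v else arr s b j).

(* [exec W p s t s']: started in [s], the program [p] halts in [s'] after [t]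
   elementary steps.  Machine words hold the numbers up to [W]; a program that
   computes a larger number is stuck, so big integers cannot be used to do a
   lot of work in one step. *)
Inductive exec (W : nat) : cmd -> state -> nat -> state -> Prop :=
  | exec_Skip s : exec W Skip s 1 s
  | exec_Assign x e s :
      eval s e <= W -> exec W (Assign x e) s 1 (set_var s x (eval s e))
  | exec_Store a x y s :
      exec W (Store a x y) s 1 (set_arr s a (var s x) (var s y))
  | exec_Seq p q s1 s2 s3 t u :
      exec W p s1 t s2 -> exec W q s2 u s3 -> exec W (Seq p q) s1 (t + u) s3
  | exec_IfT b p q s s' t :
      holds s b -> exec W p s t s' -> exec W (If b p q) s t.+1 s'
  | exec_IfF b p q s s' t :
      ~~ holds s b -> exec W q s t s' -> exec W (If b p q) s t.+1 s'
  | exec_WhileF b p s :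
      ~~ holds s b -> exec W (While b p) s 1 s
  | exec_WhileT b p s1 s2 s3 t u :
      holds s1 b -> exec W p s1 t s2 -> exec W (While b p) s2 u s3 ->
      exec W (While b p) s1 (t + u).+1 s3.

Lemma exec_det W p s t1 s1 t2 s2 :
  exec W p s t1 s1 -> exec W p s t2 s2 -> t1 = t2 /\ s1 = s2.
Proof.
move=> E1; elim: E1 t2 s2 => {p s t1 s1}; intros;
  match goal with E : exec _ _ _ _ _ |- _ = ?t /\ _ = ?s' =>
    match type of E with exec _ _ _ t s' => inversion E; subst; clear E end
  end => //;
  repeat match goal with
  | h1 : is_true (~~ holds ?s ?b), h2 : is_true (holds ?s ?b) |- _ =>
      by rewrite h2 in h1
  | IH : forall t s, exec ?W ?p ?s0 t s -> _, E : exec ?W ?p ?s0 _ _ |- _ =>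
      case: (IH _ _ E) => ? ?; subst; clear IH
  end => //.
Qed.

(* [es] lists the hyperedges of [H] without repetition, in any order, each one
   as a repetition-free list of its vertices, in any order. *)
Definition represents (n : nat) (es : seq (seq 'I_n)) (H : {set {set 'I_n}}) :
    Prop :=
  [/\ all uniq es,
      uniq [seq [set x in e] | e <- es]
    & [set:: [seq [set x in e] | e <- es]] = H].

(* The number of vertices, the number of hyperedges, then for each hyperedge its
   size followed by its vertices. *)
Definition encode (n : nat) (es : seq (seq 'I_n)) : seq nat :=
  n :: size es :: flatten [seq size e :: [seq val x | x <- e] | e <- es].

(* The input is in array 0; all other cells and all variables are 0. *)
Definition init_state (w : seq nat) : state :=
  State (fun=> 0) (fun a i => if a == 0 then nth 0 w i else 0).

(* The color of vertex [v] is left in cell [v] of array 1. *)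
Definition output (n : nat) (s : state) : 'I_n -> nat := fun v => arr s 1 v.

(* Main.v *)
Require Import Defs.
From mathcomp Require Import all_boot zify.

(** The graph joining two vertices when they lie in a common hyperedge is
    (k-1)-degenerate.  Suppose that every vertex of a nonempty set S has at least
    k neighbours in S.  A Berge path with end v in S and i edges can be prolonged
    as long as v has a neighbour in S outside the path and outside the last
    hyperedge e (a hyperedge used earlier has no room for two more vertices);
    the path and e exclude at most i + 1 vertices, so we reach i = k - 1.  There
    prolongation must fail, so v is joined to the other end w and e contains a
    further vertex y of S; the path ending in y instead of v shows that y is
    joined to w as well.  Since k >= 3, one of these two joins is made by an
    unused hyperedge, and closing up through w gives a Berge path with k edges.

    The algorithm peels off vertices with fewer than k distinct remaining
    neighbours, using a queue, and then colors greedily in the reverse order.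
    Repeated neighbours are detected by stamping them with the current vertex,
    which keeps the total work linear. *)

Set Implicit Arguments.
Unset Strict Implicit.
Unset Printing Implicit Defensive.

(** * Degeneracy of the shadow graph *)

Section Degeneracy.
Variables (V : finType) (H : {set {set V}}).

Definition shadow : rel V :=
  fun u v => (u != v) && [exists e in H, (u \in e) && (v \in e)].

(** Each entry records the hyperedge taken and the vertex reached. Paths grow at the start [v], so
    the newest hyperedge is the head of [unzip1 l]. *)
Fixpoint walk (v : V) (l : seq ({set V} * V)) : bool :=
  if l is (e, u) :: l' then [&& e \in H, v \in e, u \in e & walk u l'] else true.

Definition berge_path v l :=
  [/\ walk v l, uniq (v :: unzip2 l) & uniq (unzip1 l)].

Lemma walk_nth v l i : walk v l -> i < size l ->
  let e := nth set0 (unzip1 l) i in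
  [/\ e \in H, nth v (v :: unzip2 l) i \in e & nth v (v :: unzip2 l) i.+1 \in e].
Proof.
elim: l v i => [|[e u] l IH] v [|i] //= /and4P[eH ve ue lw] il //.
have := IH u i lw il.
by rewrite /= !(set_nth_default u v) //= size_map // ltnS ltnW.
Qed.

Lemma berge_path_contains v l :
  berge_path v l -> contains_berge H (path_graph (size l)).
Proof.
case=> lw lv le; set n := size l.
(* The endpoints of the edge [{x, x+1}] sum to [2x + 1], whose half recovers the position [x] from
   the unordered edge. *)
pose idx (X : {set 'I_n.+1}) := (\sum_(i in X) i)./2.
have idxE (x y : 'I_n.+1) : x.+1 = y -> idx [set x; y] = x.
  move=> xy; rewrite /idx big_setU1 ?big_set1 ?inE; last first.
    by rewrite -val_eqE /=; lia.
  by rewrite /=; lia.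
have edgeP X : X \in edges (path_graph n) ->
    exists x y : 'I_n.+1, x.+1 = y /\ X = [set x; y].
  case/imsetP=> -[x y]; rewrite inE /= => /orP[] /eqP xy ->; first by exists x, y.
  by exists y, x; rewrite setUC.
exists (fun X => nth set0 (unzip1 l) (idx X)), (fun i : 'I_n.+1 => nth v (v :: unzip2 l) i).
split.
- move=> _ /edgeP[x [y [xy ->]]]; rewrite idxE //.
  have xl : x < size l by have := ltn_ord y; rewrite -xy.
  by case: (walk_nth lw xl).
- move=> _ _ /edgeP[x [y [xy ->]]] /edgeP[x' [y' [xy' ->]]]; rewrite !idxE //.
  have := ltn_ord y; have := ltn_ord y'; rewrite -xy -xy' !ltnS => xl' xl.
  move/eqP; rewrite nth_uniq ?size_map // => /eqP xx.
  by congr [set _; _]; apply: val_inj => //=; rewrite -xy -xy' xx.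
- move=> x y /eqP; rewrite nth_uniq //= ?size_map //.
  by move/eqP/val_inj.
- have sub (x y : 'I_n.+1) : x.+1 = y ->
      [set nth v (v :: unzip2 l) x; nth v (v :: unzip2 l) y]
        \subset nth set0 (unzip1 l) (idx [set x; y]).
    move=> xy; rewrite idxE //; have := ltn_ord y; rewrite -xy ltnS => xl.
    case: (walk_nth lw xl) => _ h1 h2; apply/subsetP=> z.
    by rewrite !inE => /orP[] /eqP ->.
  move=> x y /orP[] /eqP xy; first exact: sub.
  by rewrite [[set x; y]]setUC setUC; apply: sub.
Qed.

Hypothesis small : forall e, e \in H -> #|e| <= 3.

Lemma no_four e a b c d : e \in H -> a \in e -> b \in e -> c \in e -> d \in e ->
  uniq [:: a; b; c; d] -> False.
Proof.
move=> /small e3 ae be ce de u4.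
have : size [:: a; b; c; d] <= size (enum e).
  by apply: uniq_leq_size u4 _ => x; rewrite mem_enum !inE => /or4P[] /eqP ->.
by rewrite -cardE /=; lia.
Qed.

Lemma walk_edge v l e : walk v l -> uniq (v :: unzip2 l) -> e \in unzip1 l ->
  [/\ e \in H & exists a b,
    [/\ a \in v :: unzip2 l, b \in v :: unzip2 l, a != b, a \in e & b \in e]].
Proof.
elim: l v => [|[f u] l IH] v //= /and4P[fH vf uf lw] /andP[vn un].
rewrite inE => /orP[/eqP ->|el].
  split=> //; exists v, u; rewrite !inE !eqxx ?orbT; split=> //.
  by move: vn; rewrite inE => /norP[].
have [eH [a [b [al bl ab ae be]]]] := IH u lw un el.
by split=> //; exists a, b; rewrite ![_ \in v :: _]in_cons al bl !orbT.
Qed.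

(** A hyperedge of the walk contains the two consecutive vertices that it joins; unless it belongs
    to the final step, both differ from the last vertex, as the vertices are distinct. *)
Lemma walk_edge_last v l e : walk v l -> uniq (v :: unzip2 l) -> e \in unzip1 l ->
  e = last set0 (unzip1 l) \/
  exists a b, [/\ a \in v :: unzip2 l, b \in v :: unzip2 l,
                  uniq [:: a; b; last v (unzip2 l)], a \in e & b \in e].
Proof.
elim: l v => [|[f u] l IH] v //= /and4P[fH vf uf lw] /andP[vn un].
rewrite inE => /orP[/eqP ->|el].
  case: l IH lw un vn => [|[g w] l] IH lw un vn; first by left.
  right; exists v, u; rewrite !inE !eqxx ?orbT; split=> //.
  move: vn un; rewrite in_cons => /norP[vu vn] /andP[un _].
  rewrite !negb_or vu !andbT /=; apply/andP; split.
    by apply: contraNneq vn => ->; rewrite mem_last.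
  by apply: contraNneq un => ->; rewrite mem_last.
case: (IH u lw un el) => [->|[a [b [al bl ab ae be]]]].
  by left; case: (l) el.
by right; exists a, b; rewrite ![_ \in v :: _]in_cons al bl !orbT.
Qed.

Lemma walk_rcons v l e u : walk v (rcons l (e, u)) =
  [&& walk v l, e \in H, last v (unzip2 l) \in e & u \in e].
Proof. by elim: l v => [|[f w] l IH] v /=; rewrite ?andbT // IH -!andbA. Qed.

(** The hyperedge [f] is new: it is not the first one, which avoids [u], and a later one already
    contains two path vertices other than [v], hence would have four vertices together with [v] and
    [u]. *)
Lemma berge_path_extend v l f u : berge_path v l -> f \in H -> u \in f -> v \in f ->
  u \notin v :: unzip2 l -> u \notin head set0 (unzip1 l) ->
  berge_path u ((f, v) :: l).
Proof.
case=> lw lv le fH uf vf un uh; split; rewrite /= ?fH ?uf ?vf ?un //=.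
rewrite le andbT; apply/negP=> fl.
case: l lw lv le un uh fl => [|[e1 v1] l] //= /and4P[e1H ve1 v1e1 lw] /andP[vn lv].
move=> /andP[e1n le] un uh; rewrite inE => /orP[/eqP ef|fl].
  by rewrite -ef uf in uh.
have [_ [a [b [al bl ab af bf]]]] := walk_edge lw lv fl.
apply: (no_four fH af bf vf uf); rewrite /= !inE !negb_or ab /= !andbT.
have ne (x y : V) (s : seq V) : x \in s -> y \notin s -> x != y.
  by move=> h; apply: contraNneq => <-.
move: un; rewrite inE => /norP[uv un].
by rewrite (ne _ _ _ al vn) (ne _ _ _ al un) (ne _ _ _ bl vn) (ne _ _ _ bl un) eq_sym uv.
Qed.

Variables (k : nat) (S : {set V}).
Hypotheses (k_ge3 : 3 <= k) (S_neq0 : S != set0).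
Hypothesis free : ~ contains_berge H (path_graph k).
Hypothesis deg_ge : forall v, v \in S -> k <= #|[set u in S | shadow v u]|.

Lemma escape v (X : {set V}) : v \in S -> #|X| < k ->
  exists2 u, u \notin X & u \in S /\ shadow v u.
Proof.
move=> vS Xk.
have /subsetPn[u] : ~~ ([set u in S | shadow v u] \subset X).
  by apply/negP=> /subset_leq_card; have := deg_ge vS; lia.
by rewrite inE => /andP[uS vu] uX; exists u.
Qed.

(** The vertices at which prolonging from [v] may fail. The vertex [v] is removed because it is
    never its own neighbour, which makes the bound of [card_blocked] sharp enough. *)
Let blocked v (l : seq ({set V} * V)) :=
  [set x in unzip2 l] :|: (head set0 (unzip1 l) :\ v).

(** Of the at most three vertices of the newest hyperedge, [v] is removed and the next path vertex
    is already counted, so this hyperedge adds at most one to the [size l] path vertices. *)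
Lemma card_blocked v l : berge_path v l -> #|blocked v l| <= (size l).+1.
Proof.
case=> lw lv _; rewrite /blocked.
case: l lw lv => [|[e u] l] /=.
  move=> _ _; have -> : [set x in [::]] :|: set0 :\ v = set0 :> {set V}.
    by apply/setP=> x; rewrite !inE andbF.
  by rewrite cards0.
move=> /and4P[eH ve ue lw]; rewrite inE negb_or => /andP[/andP[vu _] _].
have -> : [set x in u :: unzip2 l] :|: e :\ v = [set x in u :: unzip2 l] :|: e :\ v :\ u.
  by apply/setP=> x; rewrite !inE; case: (x == u).
apply: leq_trans (leq_card_setU _ _) _.
have := cardsD1 v e; have := cardsD1 u (e :\ v).
rewrite ve !inE eq_sym vu ue; have := small eH.
have : #|[set x in u :: unzip2 l]| <= (size l).+1.
  by rewrite cardsE (leq_trans (card_size _)) //= size_map.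
lia.
Qed.

Lemma extend_in v l u : berge_path v l -> v \in S -> u \in S -> shadow v u ->
  u \notin blocked v l -> exists2 l', berge_path u l' & size l' = (size l).+1.
Proof.
move=> lP vS uS /andP[vu /existsP[f /and3P[fH vf uf]]].
rewrite !inE negb_or eq_sym vu /= => /andP[ul uh].
exists ((f, v) :: l) => //; apply: berge_path_extend => //.
by rewrite inE negb_or eq_sym vu.
Qed.

Lemma long_path i : i < k -> exists v l, [/\ v \in S, berge_path v l & size l = i].
Proof.
elim: i => [|i IH] ik.
  by have /set0Pn[v vS] := S_neq0; exists v, [::].
have [v [l [vS lP li]]] := IH (ltnW ik).
have [|u uX [uS vu]] := @escape v (blocked v l) vS.
  by have := card_blocked lP; lia.
have [l' l'P l's] := extend_in lP vS uS vu uX.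
by exists u, l'; rewrite l's li.
Qed.

(** A path with [k - 1] edges cannot be prolonged, so the neighbours of [v] in [S] are all blocked.
    There are at least [k] of them and at most [k] blocked vertices, so the two sets coincide. *)
Lemma blocked_nbr v l u : v \in S -> berge_path v l -> (size l).+1 = k ->
  u \in blocked v l -> u \in S /\ shadow v u.
Proof.
move=> vS lP lk.
suff /eqP <- : [set u in S | shadow v u] == blocked v l by rewrite inE => /andP.
rewrite eqEcard; apply/andP; split; last first.
  by apply: leq_trans (card_blocked lP) _; rewrite lk; apply: deg_ge.
apply/subsetP=> w; rewrite inE => /andP[wS vw]; apply/negPn/negP=> wX.
have [l' l'P l's] := extend_in lP vS wS vw wX.
by case: free; rewrite -lk -l's; apply: berge_path_contains l'P.
Qed.

Lemma not_all_large_degree : False.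
Proof.
have [v [l [vS lP ls]]] : exists v l, [/\ v \in S, berge_path v l & size l = k.-1].
  by apply: long_path; lia.
have lk : (size l).+1 = k by lia.
(* Besides [v] the path has only [k - 1] vertices, so some neighbour [y] lies off the path; being
   blocked, it is the third vertex of the newest hyperedge. *)
have [|y yX [yS vy]] := @escape v [set x in unzip2 l] vS.
  by rewrite cardsE (leq_ltn_trans (card_size _)) // size_map; lia.
have yB : y \in blocked v l.
  apply/negPn/negP=> yB; have [l' l'P l's] := extend_in lP vS yS vy yB.
  by case: free; rewrite -lk -l's; apply: berge_path_contains l'P.
move: yX yB; rewrite !inE => yl; rewrite (negbTE yl) /=.
case/andP=> yv yh.
(* Since [y] lies in the same hyperedge, it can take the place of [v] as the start. *)
have yP : berge_path y l.
  case: lP => lw lv le; split=> //; last by rewrite /= yl; case/andP: lv.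
  by case: (l) lw yh => [|[e u] l0] //= /and4P[-> _ -> ->] ->.
case: l ls lk lP yl yh yP => [|[e v1] l] ls lk lP yl yh yP; first by move: ls => /=; lia.
(* Here [k >= 3] enters: at least one step follows [e], so the far end [w] differs from [v1] and the
   final hyperedge lies beyond [e]. *)
have l_gt0 : 0 < size l by move: ls k_ge3 => /=; clear; lia.
pose w := last v1 (unzip2 l).
have wl : w \in v1 :: unzip2 l by apply: mem_last.
have wB x : w \in blocked x ((e, v1) :: l) by rewrite in_setU !inE -in_cons wl.
have [_ /andP[vw /existsP[f /and3P[fH vf wf]]]] := blocked_nbr vS lP lk (wB v).
have [_ /andP[yw /existsP[g /and3P[gH yg wg]]]] := blocked_nbr yS yP lk (wB y).
(* Otherwise the path started at the twin [x'] could be followed to [w] and then along [h] to [x],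
   which makes [k] edges. *)
have close x x' h : berge_path x ((e, v1) :: l) -> berge_path x' ((e, v1) :: l) ->
    x != x' -> h \in H -> x \in h -> w \in h -> h \in e :: unzip1 l.
  move=> xP [x'w x'v x'e] xx hH xh wh; apply/negPn/negP=> hl.
  case: free; rewrite -lk -(size_rcons ((e, v1) :: l) (h, x)).
  apply: (@berge_path_contains x'); split.
  - by rewrite walk_rcons x'w hH wh xh.
  - rewrite /unzip2 map_rcons -rcons_cons rcons_uniq x'v andbT inE negb_or xx /=.
    by case: xP => _ /andP[].
  - by rewrite /unzip1 map_rcons rcons_uniq hl.
have fl := close _ _ _ lP yP _ fH vf wf; have gl := close _ _ _ yP lP yv gH yg wg.
have {fl} : f \in e :: unzip1 l by apply: fl; rewrite eq_sym.
case: (lP) => /= /and4P[eH ve v1e lw] /andP[vl lv] _.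
have ne (x z : V) (s : seq V) : x \in s -> z \notin s -> x != z.
  by move=> h; apply: contraNneq => <-.
have wv1 : w != v1.
  move: lv; rewrite /= => /andP[v1l _]; apply: contraNneq v1l => <-; rewrite /w.
  by case: (l) l_gt0 => [|[e2 v2] l2] //= _; rewrite mem_last.
have vv1 : v1 != v by apply: ne vl; rewrite mem_head.
have yv1 : v1 != y by apply: ne yl; rewrite mem_head.
have we : w \notin e.
  apply/negP=> we; apply: (no_four eH ve v1e yh we).
  rewrite /= !inE !negb_or vw yw /= eq_sym vv1 eq_sym yv /= yv1.
  by rewrite eq_sym wv1.
(* Any other used hyperedge holds two path vertices besides [w], hence four vertices with [w] and
   [x]. *)
have last_edge x h : h \in H -> x \in h -> w \in h -> x \notin v1 :: unzip2 l ->
    h \in e :: unzip1 l -> h = last set0 (unzip1 l).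
  move=> hH xh wh xl; rewrite inE => /orP[/eqP he|hl]; first by rewrite he (negbTE we) in wh.
  case: (walk_edge_last lw lv hl) => // -[a [b [al bl ab ah bh]]].
  case: (no_four hH ah bh wh xh); move: ab.
  rewrite /= !inE !negb_or !andbT => /andP[/andP[-> ->]] ->.
  by rewrite (ne _ _ _ al xl) (ne _ _ _ bl xl) (ne _ _ _ wl xl).
(* So [f] and [g] are both the final hyperedge, which then contains [v], [y] and two vertices of the
   remaining path: one too many. *)
move=> /(last_edge _ _ fH vf wf vl) fE; move: gl => /(last_edge _ _ gH yg wg yl) gE.
have fl : f \in unzip1 l.
  by rewrite fE; case: (l) l_gt0 => [|[e2 v2] l2] //= _; rewrite mem_last.
have [_ [a [b [al bl ab af bf]]]] := walk_edge lw lv fl.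
have yf : y \in f by rewrite fE -gE.
apply: (no_four fH af bf vf yf); rewrite /= !inE !negb_or ab /= !andbT.
by rewrite (ne _ _ _ al vl) (ne _ _ _ al yl) (ne _ _ _ bl vl) (ne _ _ _ bl yl) eq_sym yv.
Qed.

End Degeneracy.

(** * A weakest-precondition calculus with time bounds *)

Definition wp W p s T (Q : state -> Prop) :=
  exists t s', [/\ exec W p s t s', t <= T & Q s'].

Fixpoint written_vars p : seq nat :=
  match p with
  | Assign x _ => [:: x]
  | Seq p q | If _ p q => written_vars p ++ written_vars q
  | While _ p => written_vars p
  | _ => [::]
  end.

Fixpoint written_arrs p : seq nat :=
  match p with
  | Store a _ _ => [:: a]
  | Seq p q | If _ p q => written_arrs p ++ written_arrs q
  | While _ p => written_arrs p
  | _ => [::]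
  end.

Definition frame p s s' :=
  (forall x, x \notin written_vars p -> var s' x = var s x) /\
  (forall a, a \notin written_arrs p -> forall i, arr s' a i = arr s a i).

Lemma frame_refl p s : frame p s s. Proof. by []. Qed.

Lemma frame_trans p s1 s2 s3 : frame p s1 s2 -> frame p s2 s3 -> frame p s1 s3.
Proof.
move=> [v12 a12] [v23 a23].
by split=> [x xp | a ap i]; [rewrite v23 ?v12 | rewrite a23 ?a12].
Qed.

Lemma frame_sub p q s s' : {subset written_vars p <= written_vars q} ->
  {subset written_arrs p <= written_arrs q} -> frame p s s' -> frame q s s'.
Proof.
move=> sv sa [hv ha]; split=> [x xq | a aq]; [apply: hv | apply: ha].
  by apply: contra xq; apply: sv.
by apply: contra aq; apply: sa.
Qed.

Lemma exec_frame W p s t s' : exec W p s t s' -> frame p s s'.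
Proof.
elim=> {p s t s'} //=.
- by move=> x e s _; split=> // y; rewrite inE /= => /negbTE ->.
- by move=> a x y s; split=> // b; rewrite inE /= => /negbTE -> .
- move=> p q s1 s2 s3 t u _ f1 _ f2; apply: (@frame_trans _ _ s2).
    by apply: frame_sub f1 => z zp; rewrite mem_cat zp.
  by apply: frame_sub f2 => z zp; rewrite mem_cat zp orbT.
- by move=> b p q s s' t _ _; apply: frame_sub => z zp; rewrite mem_cat zp.
- by move=> b p q s s' t _ _; apply: frame_sub => z zp; rewrite mem_cat zp orbT.
- by move=> b p s1 s2 s3 t u _ _ f1 _ f2; apply: frame_trans f1 f2.
Qed.

(** The frame is handed to the implication, so postconditions need not list what the code leaves
    untouched. *)
Lemma wp_conseq W p s T T' (Q Q' : state -> Prop) : T <= T' ->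
  (forall s', frame p s s' -> Q s' -> Q' s') -> wp W p s T Q -> wp W p s T' Q'.
Proof.
move=> TT QQ [t [s' [ps tT Qs]]]; exists t, s'; split=> //; first exact: leq_trans TT.
by apply: QQ Qs; apply: exec_frame ps.
Qed.

Lemma wp_seq W p q s T1 T2 Q :
  wp W p s T1 (fun s' => wp W q s' T2 Q) -> wp W (Seq p q) s (T1 + T2) Q.
Proof.
move=> [t [s' [ps tT [u [s'' [qs uT Qs]]]]]]; exists (t + u), s''; split=> //.
  by apply: exec_Seq ps qs.
by apply: leq_add.
Qed.

(** The invariant is indexed by the remaining time budget, which doubles as the termination measure.
    The strict inequality pays for the successful test of each round, and the final [+1] for the
    failing one. *)
Lemma wp_while W b p s (I : nat -> state -> Prop) T : I T s ->
  (forall T s', frame p s s' -> I T s' -> holds s' b ->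
     exists c T', wp W p s' c (I T') /\ c + T' < T) ->
  wp W (While b p) s T.+1
    (fun s' => [/\ frame p s s', ~~ holds s' b & exists T', I T' s']).
Proof.
move=> Is step.
suff H T0 s' : frame p s s' -> I T0 s' -> wp W (While b p) s' T0.+1
    (fun s' => [/\ frame p s s', ~~ holds s' b & exists T', I T' s']).
  by apply: H Is; apply: frame_refl.
elim/ltn_ind: T0 s' => T0 IH s' fs Is'.
case: (boolP (holds s' b)) => bs; last first.
  by exists 1, s'; split=> //; [apply: exec_WhileF | split=> //; exists T0].
have [c [T' [[t [s1 [e1 tc I1]]] lt]]] := step _ _ fs Is' bs.
have T'T : T' < T0 by lia.
have [u [s2 [e2 uT Q2]]] := IH _ T'T s1 (frame_trans fs (exec_frame e1)) I1.
by exists (t + u).+1, s2; split=> //; [apply: exec_WhileT bs e1 e2 | lia].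
Qed.

Lemma wp_if W b p q s T Q :
  (if holds s b then wp W p s T Q else wp W q s T Q) -> wp W (If b p q) s T.+1 Q.
Proof.
case: ifPn => bs [t [s' [e tT Qs]]]; exists t.+1, s'; split=> //.
  exact: exec_IfT.
exact: exec_IfF.
Qed.

(* Loop-free code: its effect is computed by [step], provided that no
   intermediate value exceeds the word size. *)

Fixpoint cost p : nat :=
  match p with
  | Seq p q => cost p + cost q
  | If _ p q => (maxn (cost p) (cost q)).+1
  | _ => 1
  end.

Fixpoint step p s : state :=
  match p with
  | Assign x e => set_var s x (eval s e)
  | Store a x y => set_arr s a (var s x) (var s y)
  | Seq p q => step q (step p s)
  | If b p q => if holds s b then step p s else step q s
  | _ => s
  end.

Fixpoint safe W p s : Prop :=
  match p with
  | Assign _ e => eval s e <= W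
  | Seq p q => safe W p s /\ safe W q (step p s)
  | If b p q => if holds s b then safe W p s else safe W q s
  | While _ _ => False
  | _ => True
  end.

Lemma wp_block W p s (Q : state -> Prop) :
  safe W p s -> Q (step p s) -> wp W p s (cost p) Q.
Proof.
elim: p s Q => //=.
- by move=> s Q _ Qs; exists 1, s; split=> //; apply: exec_Skip.
- by move=> x e s Q W1 Qs; exists 1; eexists; split; [apply: exec_Assign | | apply: Qs].
- by move=> a x y s Q _ Qs; exists 1; eexists; split; [apply: exec_Store | | apply: Qs].
- by move=> p IHp q IHq s Q [sp sq] Qs; apply: wp_seq; apply: IHp => //; apply: IHq.
- move=> b p IHp q IHq s Q; case: ifPn => bs sp Qs.
    have [t [s' [e tc Qs']]] := IHp _ _ sp Qs.
    by exists t.+1, s'; split=> //; [apply: exec_IfT | lia].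
  have [t [s' [e tc Qs']]] := IHq _ _ sp Qs.
  by exists t.+1, s'; split=> //; [apply: exec_IfF | lia].
Qed.

Lemma wp_block_le W p s T (Q : state -> Prop) : cost p <= T ->
  safe W p s -> Q (step p s) -> wp W p s T Q.
Proof. by move=> cT sp Qs; apply: wp_conseq cT _ (wp_block sp Qs). Qed.

(** * Adjacency lists *)

(** Pointer 0 ends a list. The bound [b] is the number of allocated nodes, so that writing node
    [b.+1] cannot disturb existing lists. *)
Fixpoint linked (vl nx : nat -> nat) b c (l : seq nat) : Prop :=
  if l is y :: l' then [/\ 0 < c <= b, vl c = y & linked vl nx b (nx c) l']
  else c = 0.

Lemma linked_le vl nx b c l : linked vl nx b c l -> c <= b.
Proof. by case: l => [->|y l [/andP[]]]. Qed.

Lemma eq_linked vl nx vl' nx' b b' c l : b <= b' ->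
  (forall i, i <= b -> vl' i = vl i /\ nx' i = nx i) ->
  linked vl nx b c l -> linked vl' nx' b' c l.
Proof.
move=> bb e; elim: l c => //= y l IH c [cb yc ll].
case/andP: cb => c0 cb; case: (e _ cb) => -> ->; split=> //.
  by rewrite c0 (leq_trans cb).
exact: IH.
Qed.

(* Registers; [ZERO] is never assigned. *)
Notation ZERO := 0 (only parsing).
Notation ONE := 1 (only parsing).
Notation KK := 2 (only parsing).
Notation NN := 3 (only parsing).
Notation MM := 4 (only parsing).
Notation POS := 5 (only parsing).
Notation CNT := 6 (only parsing).
Notation EE := 7 (only parsing).
Notation DD := 8 (only parsing).
Notation XX := 9 (only parsing).
Notation YY := 10 (only parsing).
Notation ZZ := 11 (only parsing).
Notation PTR := 12 (only parsing).
Notation UU := 13 (only parsing).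
Notation VV := 14 (only parsing).
Notation RR := 15 (only parsing).
Notation STAMP := 16 (only parsing).
Notation TAIL := 17 (only parsing).
Notation HEAD := 18 (only parsing).
Notation COL := 19 (only parsing).
Notation THREE := 20 (only parsing).

(* [HEADS] maps a vertex to the first node of its adjacency list (0 if empty);
   node [c] carries the neighbour [VALS[c]] and is followed by node [NEXTS[c]].
   [SEEN], [PEELED] and [USED] hold stamps [v.+1], so that they need not be
   cleared when the current vertex [v] changes.  [IN] and [CLR] are the arrays
   prescribed for the input and the output. *)
Notation IN := 0 (only parsing).
Notation CLR := 1 (only parsing).
Notation HEADS := 2 (only parsing).
Notation VALS := 3 (only parsing).
Notation NEXTS := 4 (only parsing).
Notation SEEN := 5 (only parsing).
Notation DEGS := 6 (only parsing).
Notation QUEUE := 7 (only parsing).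
Notation PEELED := 8 (only parsing).
Notation USED := 9 (only parsing).

Definition scan body :=
  Seq (Assign PTR (Read HEADS VV))
    (While (Lt ZERO PTR)
       (Seq (Assign UU (Read VALS PTR)) (Seq body (Assign PTR (Read NEXTS PTR))))).

(** The invariant [I] is indexed by the entries visited so far, latest first, hence ends at [rev l].
    Each entry costs [c] for the body and 3 for the test and the two reads; the first read and the
    failing test give the last 2. *)
Lemma wp_scan W body s (I : seq nat -> state -> Prop) c b l :
  ZERO \notin written_vars body -> PTR \notin written_vars body ->
  HEADS \notin written_arrs body -> VALS \notin written_arrs body ->
  NEXTS \notin written_arrs body ->
  var s ZERO = 0 -> linked (arr s VALS) (arr s NEXTS) b (arr s HEADS (var s VV)) l ->
  b <= W -> {in l, forall u, u <= W} ->
  (forall d s' i, I d s' -> I d (set_var s' PTR i)) ->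
  (forall d s' i, I d s' -> I d (set_var s' UU i)) ->
  I [::] s ->
  (forall d s', frame (scan body) s s' -> I d s' -> var s' UU \in l ->
     wp W body s' c (I (var s' UU :: d))) ->
  wp W (scan body) s (size l * c.+3 + 2) (I (rev l)).
Proof.
move=> nZ nP nH nV nN Z0 ll bW lW IP IU I0 body_ok.
have -> : size l * c.+3 + 2 = 1 + (size l * c.+3).+1 by lia.
apply: wp_seq; apply: (wp_block (p := Assign _ _)) => /=.
  by apply: leq_trans (linked_le ll) bW.
pose s0 := set_var s PTR (arr s HEADS (var s VV)); rewrite -/s0.
set bd := Seq _ _.
have nZ' : ZERO \notin written_vars (scan body) by rewrite /= !inE mem_cat !negb_or nZ.
have fsub s' : frame bd s0 s' -> frame (scan body) s s'.
  move=> fr; apply: (@frame_trans _ _ s0).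
    by split=> // x; rewrite /s0 /= inE negb_or => /andP[/negbTE ->].
  by apply: frame_sub fr => x; rewrite ?inE /= ?mem_cat => ->; rewrite ?orbT.
pose J T s' := exists d r, [/\ catrev r d = rev l, T = size r * c.+3,
  linked (arr s' VALS) (arr s' NEXTS) b (var s' PTR) r & I d s'].
have J0 : J (size l * c.+3) s0 by exists [::], l; split=> //; apply: IP.
apply: wp_conseq (wp_while J0 _) => //.
  move=> s' _ [fr nb [T [d [r [rd _ lr Id]]]]].
  suff r0 : r = [::] by rewrite -rd r0.
  case: r lr nb {rd} => // y r [/andP[c0 _] _ _]; case/negP.
  by rewrite /holds (proj1 (fsub _ fr)) // Z0.
move=> _ s' fr [d [r [rd -> lr Id]]] hb.
have Z' : var s' ZERO = 0 by rewrite (proj1 (fsub _ fr)).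
case: r rd lr => [|y r] rd /=; first by move=> c0; move: hb; rewrite /= Z' c0.
case=> c0 yE lr; exists c.+2, (size r * c.+3); split; last by lia.
have yl : y \in l by rewrite -mem_rev -rd catrevE mem_cat mem_rev inE eqxx.
rewrite -[c.+2]/(1 + c.+1) -[c.+1]addn1; apply: wp_seq.
apply: (wp_block (p := Assign _ _)) => /=; first by rewrite yE lW.
set s1 := set_var _ _ _; apply: wp_seq.
have fr1 : frame (scan body) s s1.
  apply: frame_trans (fsub _ fr) _; split=> // x.
  by rewrite /s1 /= !inE !negb_or => /and3P[_ /negbTE -> _].
have U1 : var s1 UU = y by rewrite -yE.
apply: wp_conseq (leqnn _) _ (body_ok d s1 fr1 _ _); rewrite ?U1 //; last exact: IU.
move=> s2 [v2 a2] I2.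
have e : linked (arr s2 VALS) (arr s2 NEXTS) b (arr s2 NEXTS (var s2 PTR)) r.
  by rewrite a2 // v2 //; apply: eq_linked lr => // i _; rewrite !a2.
apply: (wp_block (p := Assign _ _)); first exact: leq_trans (linked_le e) bW.
by exists (y :: d), r; split=> //; [lia | apply: IP].
Qed.

(** A neighbour is repeated when it shares several hyperedges with [v]. The order is that of the
    linked lists, where new nodes go to the front. *)
Definition nbrs (P : seq (nat * nat)) v := [seq p.2 | p <- P & p.1 == v].

Definition adjacency s P := var s CNT = size P /\
  forall v, linked (arr s VALS) (arr s NEXTS) (size P) (arr s HEADS v) (nbrs P v).

Definition push x y :=
  Seq (Assign CNT (Add CNT ONE)) (Seq (Store VALS CNT y)
  (Seq (Assign RR (Read HEADS x)) (Seq (Store NEXTS CNT RR) (Store HEADS x CNT)))).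

Lemma wp_push W x y s P : x != CNT -> x != RR -> y != CNT -> var s ONE = 1 ->
  (size P).+1 <= W -> adjacency s P ->
  wp W (push x y) s 5 (fun s' => adjacency s' ((var s x, var s y) :: P)).
Proof.
move=> xC xR yC s1 PW [cnt ls].
apply: (wp_block (p := push x y));
  rewrite /= ?s1 ?cnt ?addn1 ?(negbTE xC) ?(negbTE xR) ?(negbTE yC).
  by split=> //; split=> //; split=> //; apply: leq_trans (linked_le (ls _)) _; lia.
rewrite /adjacency /= ?cnt ?s1 ?addn1 ?(negbTE xC) ?(negbTE xR) ?(negbTE yC); split=> // v.
have ext c l : linked (arr s VALS) (arr s NEXTS) (size P) c l ->
  linked (fun j => if j == (size P).+1 then var s y else arr s VALS j)
  (fun j => if j == (size P).+1 then arr s HEADS (var s x) else arr s NEXTS j) (size P).+1 c l.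
  by apply: eq_linked => // i iP; rewrite ltn_eqF.
rewrite /nbrs /= eq_sym; case: (var s x =P v) => [<-|_] /=; last exact: ext.
by rewrite eqxx ltnSn; split=> //; apply: ext.
Qed.

(** * Reading the hyperedges into adjacency lists *)

Definition fetch x := Seq (Assign x (Read IN POS)) (Assign POS (Add POS ONE)).

Definition read_edge :=
  Seq (Seq (fetch DD) (Seq (fetch XX) (fetch YY)))
 (Seq (Seq (push XX YY) (push YY XX))
 (Seq (If (Eq DD THREE)
         (Seq (fetch ZZ) (Seq (Seq (push XX ZZ) (push ZZ XX)) (Seq (push YY ZZ) (push ZZ YY))))
         Skip)
      (Assign EE (Add EE ONE)))).

(** What a sequence of pushes preserves: [CNT] and [RR] are the only registers they change. *)
Definition same s s' := (forall x, x \notin [:: CNT; RR] -> var s' x = var s x) /\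
  (forall i, arr s' IN i = arr s IN i).

Lemma wp_push2 W x y s0 s P : x \in [:: XX; YY; ZZ] -> y \in [:: XX; YY; ZZ] ->
  var s0 ONE = 1 -> (size P).+2 <= W -> same s0 s -> adjacency s P ->
  wp W (Seq (push x y) (push y x)) s 10 (fun s' => same s0 s' /\
    adjacency s' ((var s0 y, var s0 x) :: (var s0 x, var s0 y) :: P)).
Proof.
move=> xV yV one PW ss ad.
have nC z : z \in [:: XX; YY; ZZ] -> (z != CNT) && (z != RR).
  by rewrite !inE => /or3P[] /eqP ->.
have [xC xR] := andP (nC _ xV); have [yC yR] := andP (nC _ yV).
have fs z z' s1 s2 : same s0 s1 -> frame (push z z') s1 s2 -> same s0 s2.
  move=> [v1 a1] [v2 a2]; split=> [w ww|i]; last by rewrite a2 ?a1.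
  by rewrite v2 ?v1.
have sv s1 z : same s0 s1 -> z != CNT -> z != RR -> var s1 z = var s0 z.
  by move=> [h _] zC zR; rewrite h // !inE negb_or zC.
apply: (@wp_seq _ _ _ _ 5 5).
apply: wp_conseq (wp_push xC xR yC _ (ltnW PW) ad) => //; last by rewrite sv.
move=> s1 fr1 ad1; have ss1 := fs _ _ _ _ ss fr1.
apply: wp_conseq (wp_push yC yR xC _ _ ad1) => //; last by rewrite sv.
move=> s2 fr2; rewrite !(sv s1) // !(sv s) // => ad2.
by split=> //; apply: fs fr2.
Qed.

(** The time splits as 6 for three fetches, 10 for the pair [x, y] in both directions, 23 for the
    possible third vertex and 1 for the counter. Three vertices give six ordered pairs. *)
Lemma wp_read_edge W s e rest P : (size e == 2) || (size e == 3) -> uniq e ->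
  var s ONE = 1 -> var s THREE = 3 ->
  (forall i, arr s IN (var s POS + i) = nth 0 (size e :: e ++ rest) i) ->
  adjacency s P -> var s POS + 4 <= W -> size P + 6 <= W -> var s EE < W ->
  {in e, forall x, x <= W} ->
  wp W read_edge s 40 (fun s' => exists Q, [/\ adjacency s' (Q ++ P), size Q <= 6,
    forall u v, ((u, v) \in Q) = [&& u \in e, v \in e & u != v],
    var s' POS = var s POS + (size e).+1 & var s' EE = var s EE + 1]).
Proof.
move=> es ue one three inp ad pW PW eW xW.
have inp0 := inp 0; have inp1 := inp 1; have inp2 := inp 2; have inp3 := inp 3.
have [x [y [l eE]]] : exists x y l, e = [:: x, y & l].
  by case: e es {inp ue xW inp0 inp1 inp2 inp3} => [|x [|y l]] //; exists x, y, l.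
have xW' : x <= W by apply: xW; rewrite eE !inE eqxx.
have yW' : y <= W by apply: xW; rewrite eE !inE eqxx orbT.
rewrite addn0 /= in inp0; rewrite eE /= in inp1; rewrite eE /= in inp2.
apply: (@wp_seq _ _ _ _ 6 34); apply: (wp_block (p := Seq _ _)).
  rewrite /= one inp0 inp1 -!addnA inp2; do ! split=> //; by [lia | case/orP: es => /eqP ->; lia].
set s1 := step _ _.
have v1 : [/\ var s1 ONE = 1, var s1 THREE = 3, var s1 DD = size e, var s1 XX = x &
    var s1 YY = y] /\ [/\ var s1 POS = var s POS + 3, var s1 EE = var s EE
    & forall i, arr s1 IN i = arr s IN i].
  by split; split=> //=; rewrite ?one ?inp0 ?inp1 -?addnA ?inp2.
have ad1 : adjacency s1 P by [].
move: s1 v1 ad1 => s1 [[one1 three1 D1 X1 Y1] [P1 E1 I1]] ad1.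
apply: (@wp_seq _ _ _ _ 10 24).
apply: wp_conseq (wp_push2 (s0 := s1) _ _ one1 _ _ ad1) => //; last by lia.
move=> s2 _ []; rewrite X1 Y1 => -[v2 a2] ad2.
pose Q1 := [:: (y, x); (x, y)].
apply: (@wp_seq _ _ _ _ 23 1); apply: wp_if; rewrite /holds !v2 // D1 three1.
case: ifPn => [e3|en3].
  have [z lE] : exists z, l = [:: z].
    by move: e3; rewrite eE; case: (l) => [|z [|]] //; exists z.
  rewrite {}lE in eE; rewrite eE /= in inp3.
  have zW : z <= W by apply: xW; rewrite eE !inE eqxx !orbT.
  have rd : arr s2 IN (var s2 POS) = z by rewrite a2 I1 v2 // P1.
  apply: (@wp_seq _ _ _ _ 2 20); apply: (wp_block (p := fetch ZZ)).
    by rewrite /= rd !v2 // one1 P1; split=> //; lia.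
  set s3 := step _ _.
  have [one3 X3 Y3 Z3 ad3] : [/\ var s3 ONE = 1, var s3 XX = x, var s3 YY = y,
      var s3 ZZ = z & adjacency s3 (Q1 ++ P)] by split=> //=; rewrite ?rd ?v2.
  have [P3 E3] : var s3 POS = var s POS + 4 /\ var s3 EE = var s EE.
    by rewrite /= !v2 // one1 P1 E1 -addnA.
  move: s3 one3 X3 Y3 Z3 ad3 P3 E3 => s3 one3 X3 Y3 Z3 ad3 P3 E3.
  apply: (@wp_seq _ _ _ _ 10 10).
  apply: wp_conseq (wp_push2 (s0 := s3) _ _ one3 _ _ ad3) => //; last by rewrite /=; lia.
  move=> s4 _ []; rewrite X3 Z3 => ss4 ad4.
  apply: wp_conseq (wp_push2 (s0 := s3) _ _ one3 _ ss4 ad4) => //; last by rewrite /=; lia.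
  move=> s5 _ []; rewrite Y3 Z3 => -[v5 _] ad5.
  apply: (wp_block (p := Assign _ _)); first by rewrite /= !v5 // one3 E3 addn1.
  exists [:: (z, y), (y, z), (z, x), (x, z) & Q1]; split=> //=.
  - move=> u v; rewrite !inE !xpair_eqE eE !inE; move: ue; rewrite eE /= !inE !andbT !negb_or.
    case/andP=> /andP[xy xz] yz.
    have ne : [&& y != x, z != x & z != y] by rewrite eq_sym xy eq_sym xz eq_sym yz.
    case/and3P: ne => yx zx zy; apply/idP/and3P.
      by do ![case/orP]; case/andP=> /eqP -> /eqP ->; rewrite !eqxx ?orbT; split.
    by case; do ![case/orP]; move/eqP=> ->; do ![case/orP]; move/eqP=> ->; rewrite !eqxx ?orbT.
  - by rewrite v5 // P3 (eqP e3).
  - by rewrite !v5 // E3 one3.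
have {}eE : e = [:: x; y].
  by move: es en3; rewrite eE; case: (l) => [|z [|]].
apply: (@wp_conseq _ _ _ (cost Skip) _ (eq s2)) => //; last exact: wp_block.
move=> _ _ <-.
apply: (wp_block (p := Assign _ _)); first by rewrite /= !v2 // one1 E1 addn1.
exists Q1; split=> //=.
- move=> u v; rewrite !inE !xpair_eqE eE !inE; move: ue; rewrite eE /= !inE !andbT.
  move=> xy; have yx : y != x by rewrite eq_sym.
  apply/idP/and3P.
    by case/orP; case/andP=> /eqP -> /eqP ->; rewrite !eqxx ?orbT; split.
  by case; case/orP; move/eqP=> ->; case/orP; move/eqP=> ->; rewrite !eqxx ?orbT.
- by rewrite v2 // P1 eE.
- by rewrite !v2 // E1 one1.
Qed.

Definition joined (u v : nat) (e : seq nat) := [&& u \in e, v \in e & u != v].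

Lemma wp_read_edges W s (ns : seq (seq nat)) :
  (forall e, e \in ns -> [/\ (size e == 2) || (size e == 3), uniq e & {in e, forall x, x <= W}]) ->
  var s ONE = 1 -> var s THREE = 3 -> var s EE = 0 -> var s MM = size ns ->
  var s POS = 2 ->
  (forall i, arr s IN (2 + i) = nth 0 (flatten [seq size e :: e | e <- ns]) i) ->
  adjacency s [::] -> 6 * size ns + 2 <= W ->
  wp W (While (Lt EE MM) read_edge) s (41 * size ns).+1 (fun s' => exists P,
    [/\ adjacency s' P, size P <= 6 * size ns &
        forall u v, ((u, v) \in P) = has (joined u v) ns]).
Proof.
move=> nsP one three E0 MS P2 inp ad0 mW.
(* [d] is read and [r] is still to come. A hyperedge occupies at most four cells after the two
   header cells, which keeps [POS] within the word size. *)
pose J T s' := exists d r P, [/\ ns = d ++ r, T = 41 * size r, var s' EE = size d,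
  var s' POS <= 2 + 4 * size d & [/\ adjacency s' P, size P <= 6 * size d,
  forall i, arr s IN (var s' POS + i) = nth 0 (flatten [seq size e :: e | e <- r]) i &
  forall u v, ((u, v) \in P) = has (joined u v) d]].
have J0 : J (41 * size ns) s.
  by exists [::], ns, [::]; split=> //; [rewrite P2 | split=> // i; rewrite P2].
apply: wp_conseq (wp_while J0 _) => //.
  move=> s' _ [fr nb [T [d [r [P [dr _ Es _ [ad Ps _ mP]]]]]]].
  have r0 : r = [::].
    case: r dr nb => // e r dr; rewrite /holds Es (proj1 fr MM isT) MS dr size_cat /=.
    by rewrite addnS ltnS leq_addr.
  by exists P; rewrite dr r0 cats0.
move=> T s' fr [d [r [P [dr -> Es Ps [ad sP inr mP]]]]] /=.
rewrite Es (proj1 fr MM isT) MS dr size_cat.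
case: r dr inr => [|e r] dr inr; first by rewrite addn0 ltnn.
move=> _; exists 40, (41 * size r); split; last by rewrite /=; lia.
have sns : size ns = size d + (size r).+1 by rewrite dr size_cat.
have [se ue eW] : [/\ (size e == 2) || (size e == 3), uniq e & {in e, forall x, x <= W}].
  by apply: nsP; rewrite dr mem_cat inE eqxx orbT.
have se3 : size e <= 3 by case/orP: se => /eqP ->.
clear nsP.
pose rest := flatten [seq size e :: e | e <- r].
apply: wp_conseq (wp_read_edge (rest := rest) (P := P) se ue _ _ _ ad _ _ _ _) => //.
- move=> s2 fr2 [Q [ad2 sQ mQ P2' E2]].
  exists (rcons d e), r, (Q ++ P); split=> //.
  + by rewrite cat_rcons.
  + by rewrite E2 Es size_rcons addn1.
  + by rewrite P2' size_rcons mulnS (addnCA 2) [leqRHS]addnC; apply: leq_add.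
  split=> //.
  + by rewrite size_cat size_rcons mulnS; apply: leq_add.
  + move=> i; rewrite P2' -addnA inr /= nth_cat.
    by rewrite ltnNge leq_addr /= addKn.
  + by move=> u v; rewrite mem_cat mQ mP has_rcons.
- by rewrite (proj1 fr ONE isT).
- by rewrite (proj1 fr THREE isT).
- by move=> i; rewrite (proj2 fr IN isT) inr.
- by clear -Ps sns mW; lia.
- by clear -sP sns mW; lia.
- by clear -Es sns mW; lia.
Qed.

Lemma mem_nbrs P u v : (v \in nbrs P u) = ((u, v) \in P).
Proof.
apply/mapP/idP => [[[x y]] | uv]; last by exists (u, v); rewrite ?mem_filter ?eqxx.
by rewrite mem_filter /= => /andP[/eqP -> xyP] ->.
Qed.

(** * Peeling and coloring *)

Definition queued s o :=
  var s TAIL = size o /\ forall i, i < size o -> arr s QUEUE i = nth 0 o i.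

Lemma queued_rcons s s' o v : queued s o -> var s' TAIL = (size o).+1 ->
  (forall i, arr s' QUEUE i = if i == size o then v else arr s QUEUE i) ->
  queued s' (rcons o v).
Proof.
move=> [_ q] t q'; split; rewrite size_rcons // => i; rewrite ltnS => io.
by rewrite q' nth_rcons; case: ltngtP io => // io _; apply: q.
Qed.

Definition count_nbrs := scan
  (Seq (Assign RR (Read SEEN UU))
       (If (Eq RR STAMP) Skip (Seq (Store SEEN UU STAMP) (Assign DD (Add DD ONE))))).

Definition count_degree :=
  Seq (Seq (Assign STAMP (Add VV ONE)) (Assign DD (Const 0)))
 (Seq count_nbrs
 (Seq (Store DEGS VV DD)
 (Seq (If (Lt DD KK) (Seq (Store QUEUE TAIL VV) (Assign TAIL (Add TAIL ONE))) Skip)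
      (Assign VV (Var STAMP))))).

Definition setup s n k P :=
  [/\ var s ZERO = 0, var s ONE = 1, var s KK = k, var s NN = n & adjacency s P].

(** A common time budget per vertex for the three loops below: 13 per list entry (10 for the body, 3
    for the traversal) and an overhead, with [4 * k] leaving room for the color search. *)
Definition weight k (P : seq (nat * nat)) u := size (nbrs P u) * 13 + (20 + 4 * k).

Lemma weight_gt0 k P u : 0 < weight k P u.
Proof. by rewrite /weight addnA addn_gt0 addn_gt0 orbT. Qed.

(** The side conditions are boolean, so for concrete code they are settled by computation. *)
Lemma setup_frame p s s' n k P : frame p s s' ->
  ~~ has (fun x => x \in written_vars p) [:: ZERO; ONE; KK; NN; CNT] ->
  ~~ has (fun x => x \in written_arrs p) [:: HEADS; VALS; NEXTS] ->
  setup s n k P -> setup s' n k P.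
Proof.
move=> [fv fa]; rewrite /= orbF !negb_or => /and5P[v0 v1 v2 v3 v4] /and4P[a2 a3 a4 _].
case=> s0 s1 s2 s3 [cnt ls]; split; rewrite ?fv //; split; rewrite ?fv // => v.
by rewrite fa //; apply: eq_linked (ls v) => // i _; rewrite !fa.
Qed.

Section Phases.
Variables (W n k : nat) (P : seq (nat * nat)).
Hypotheses (PW : size P <= W) (nW : n.+1 < W) (kW : k < W).
Hypothesis P_lt : forall u v : nat, (u, v) \in P -> (u < n) && (v < n).
Hypothesis P_sym : forall u v : nat, ((u, v) \in P) = ((v, u) \in P).

Lemma nbrs_lt u v : v \in nbrs P u -> v < n.
Proof. by rewrite mem_nbrs => /P_lt /andP[]. Qed.

Lemma wp_scan_nbrs body s (I : seq nat -> state -> Prop) v :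
  ~~ has (fun x => x \in written_vars body) [:: ZERO; ONE; KK; NN; CNT; PTR] ->
  ~~ has (fun x => x \in written_arrs body) [:: HEADS; VALS; NEXTS] ->
  setup s n k P -> var s VV = v ->
  (forall d s' i, I d s' -> I d (set_var s' PTR i)) ->
  (forall d s' i, I d s' -> I d (set_var s' UU i)) ->
  I [::] s ->
  (forall d s', frame (scan body) s s' -> setup s' n k P -> I d s' ->
     var s' UU \in nbrs P v -> wp W body s' 10 (I (var s' UU :: d))) ->
  wp W (scan body) s (size (nbrs P v) * 13 + 2) (I (rev (nbrs P v))).
Proof.
move=> nv na su vE IP IU I0 body_ok.
have := nv; have := na; rewrite /= !orbF !negb_or => /and3P[a2 a3 a4].
case/and5P=> v0 v1 v2 v3 /andP[v6 v12].
have [z0 _ _ _ [_ ls]] := su; have ll := ls (var s VV); rewrite {2}vE in ll.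
apply: (wp_scan v0 v12 a2 a3 a4 z0 ll PW _ IP IU I0 _).
  by move=> u /nbrs_lt un; apply: ltnW (ltn_trans un (ltnW nW)).
move=> d s' fr; apply: body_ok => //; apply: setup_frame fr _ _ su.
  by rewrite /= !in_cons !mem_cat !negb_or v0 v1 v2 v3 v6.
by rewrite /= !cats0 !negb_or a2 a3 a4.
Qed.

Lemma wp_degrees s : setup s n k P -> var s VV = 0 -> queued s [::] ->
  (forall u, arr s SEEN u = 0) ->
  wp W (While (Lt VV NN) count_degree) s (\sum_(0 <= u < n) weight k P u).+1
   (fun s' => exists o, [/\ queued s' o, uniq o,
      forall u, (u \in o) = (u < n) && (size (undup (nbrs P u)) < k) &
      forall u, u < n -> arr s' DEGS u = size (undup (nbrs P u))]).
Proof.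
move=> su V0 q0 S0.
(* All stamps so far are at most the current vertex [v], so the stamp [v.+1] is fresh when its list
   is scanned. *)
pose J T s' := exists o, [/\ var s' VV <= n, T = \sum_(var s' VV <= u < n) weight k P u,
   forall u, arr s' SEEN u <= var s' VV & [/\ queued s' o, uniq o,
      forall u, (u \in o) = (u < var s' VV) && (size (undup (nbrs P u)) < k) &
      forall u, u < var s' VV -> arr s' DEGS u = size (undup (nbrs P u))]].
have J0 : J (\sum_(0 <= u < n) weight k P u) s.
  by exists [::]; rewrite V0; split=> // u; rewrite S0.
have NnE s' : setup s' n k P -> var s' NN = n by case.
apply: wp_conseq (wp_while J0 _) => //.
  move=> s' _ [fr nb [T [o [vn _ _ ho]]]]; exists o.
  have -> // : n = var s' VV.
  by move: nb; rewrite /= (NnE _ (setup_frame fr isT isT su)); lia.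
move=> T s1 fr [o [vn -> Sv [qo uo mo dgo]]] /=.
have {fr}su1 := setup_frame fr isT isT su.
rewrite NnE //; set v := var s1 VV in vn Sv mo dgo * => lt_vn.
(* One unit of the weight is kept back for the loop test. *)
exists (weight k P v).-1, (\sum_(v.+1 <= u < n) weight k P u); split; last first.
  by rewrite [X in _ < X]big_ltn // ltn_add2r ltn_predL weight_gt0.
have -> : (weight k P v).-1 = 2 + ((size (nbrs P v) * 13 + 2) + (15 + 4 * k)).
  by rewrite /weight; lia.
have [_ one _ _ _] := su1.
apply: wp_seq; apply: (wp_block (p := Seq _ _)).
  by rewrite /= one; split=> //; rewrite -/v; lia.
set s2 := step _ _.
have st2 : var s2 STAMP = v.+1 by rewrite /= one addn1.
have su2 : setup s2 n k P by [].
pose I d s' := [/\ var s' DD = size (undup d), {subset d <= nbrs P v},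
  forall u, (arr s' SEEN u == v.+1) = (u \in d) & forall u, arr s' SEEN u <= v.+1].
have {S0} I0 : I [::] s2.
  split=> // u; last exact: leqW (Sv u).
  by rewrite ltn_eqF // ltnS; apply: Sv.
have v2 : var s2 VV = v by [].
have q2 : queued s2 o by [].
have d2 u : u < v -> arr s2 DEGS u = size (undup (nbrs P u)) by apply: dgo.
move: s2 st2 su2 I0 v2 q2 d2 => s2 st2 su2 I0 v2 q2 d2.
apply: wp_seq.
apply: wp_conseq (leqnn _) _ (wp_scan_nbrs (I := I) _ _ su2 v2 _ _ I0 _) => //; last first.
  move=> d s3 fr3 [_ one3 _ _ _] [D3 sub3 S3 le3] ul; set u := var s3 UU in ul *.
  have st3 : var s3 STAMP = v.+1 by rewrite (proj1 fr3).
  have Dn : size (undup d) <= n.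
    rewrite -(size_iota 0 n); apply: uniq_leq_size (undup_uniq d) _ => x.
    by rewrite mem_undup mem_iota => /sub3/nbrs_lt.
  have eE : (arr s3 SEEN u == v.+1) = (u \in d) by apply: S3.
  apply: wp_block_le => //.
    rewrite /= -/u st3 eE; split; first by apply: leq_trans (le3 _) _; lia.
    by case: ifP => // _; split=> //; rewrite one3 D3; lia.
  rewrite /= -/u st3 eE.
  have sub' : {subset u :: d <= nbrs P v}.
    by move=> x; rewrite inE => /orP[/eqP ->|/sub3].
  case: ifPn => ud /=.
    split=> //=; first by rewrite ud.
    by move=> x; rewrite inE S3; case: eqP => // ->.
  split=> //=.
  - by rewrite (negbTE ud) one3 D3 addn1.
  - by move=> x; rewrite inE -S3 -/u ?st3; case: (x == u) => //; rewrite eqxx.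
  - by move=> x; rewrite -/u ?st3; case: ifP.
move=> s3 fr3 [D3 _ _ le3].
have {}D3 : var s3 DD = size (undup (nbrs P v)).
  by rewrite D3; apply: perm_size; apply: perm_undup => x; rewrite mem_rev.
have [_ one3 k3 _ _] := setup_frame fr3 isT isT su2.
have st3 : var s3 STAMP = v.+1 by rewrite (proj1 fr3).
have [t3 q3] : queued s3 o.
  by case: q2 => t2 q2; split=> [|i io]; rewrite ?(proj1 fr3) ?(proj2 fr3) ?q2.
have v3 : var s3 VV = v by rewrite (proj1 fr3).
have d3 u : arr s3 DEGS u = arr s2 DEGS u by rewrite (proj2 fr3).
have on : size o <= n.
  rewrite -(size_iota 0 n); apply: uniq_leq_size uo _ => x.
  by rewrite mem_iota mo => /andP[xv _] /=; lia.
have vo : v \notin o by rewrite mo ltnn.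
have degE u : u < v.+1 -> (if u == v then size (undup (nbrs P v)) else arr s3 DEGS u) =
    size (undup (nbrs P u)).
  by rewrite ltnS leq_eqVlt d3; case: eqP => [-> //|_] /= /d2.
apply: wp_block_le => //.
- rewrite /= D3 k3; split=> //; split; first by case: ifP => //= _; rewrite t3 one3; lia.
  by case: ifP => /= _; rewrite st3; lia.
- have moS x : (x < v.+1) && (size (undup (nbrs P x)) < k) =
      (x \in o) || (x == v) && (size (undup (nbrs P v)) < k).
    rewrite ltnS leq_eqVlt mo; case: eqP => [-> |_] /=; last by rewrite orbF.
    by rewrite ltnn.
  rewrite /= D3 k3 v3; case: ifP => dk.
    exists (rcons o v); rewrite /= st3; split=> //; split.
    + by apply: (queued_rcons (s := s3)) => //=; rewrite t3 ?one3 ?addn1.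
    + by rewrite rcons_uniq vo.
    + by move=> x; rewrite moS dk andbT mem_rcons inE orbC.
    + exact: degE.
  exists o; rewrite /= st3; split=> //; split=> //.
  + by move=> x; rewrite moS dk andbF orbF.
Qed.

(** [RR] holds the degree before the decrement, so a vertex is queued exactly when its degree drops
    from [k] to [k - 1]. Vertices of smaller degree are in the queue already, hence none enters
    twice. *)
Definition peel_nbrs := scan
  (Seq (Assign RR (Read PEELED UU))
       (If (Eq RR STAMP) Skip
          (Seq (Store PEELED UU STAMP)
          (Seq (Assign RR (Read DEGS UU))
          (Seq (Assign DD (Defs.Sub RR ONE))
          (Seq (Store DEGS UU DD)
               (If (Eq RR KK) (Seq (Store QUEUE TAIL UU) (Assign TAIL (Add TAIL ONE)))
                              Skip))))))).

Definition peel_next :=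
  Seq (Seq (Assign VV (Read QUEUE HEAD)) (Assign STAMP (Add VV ONE)))
 (Seq peel_nbrs (Assign HEAD (Add HEAD ONE))).

Definition residual (p : seq nat) (u : nat) := count (fun x => x \notin p) (undup (nbrs P u)).

(** Peeling [v] costs each of its neighbours exactly one. Symmetry of [P] expresses this through the
    list of [v], the one that the program scans. *)
Lemma residual_rcons p v u : v \notin p ->
  residual (rcons p v) u = residual p u - (u \in nbrs P v).
Proof.
move=> vp; rewrite /residual mem_nbrs P_sym -mem_nbrs -mem_undup.
elim: (undup _) (undup_uniq (nbrs P u)) => //= x l IH /andP[xl /IH ->].
rewrite mem_rcons !inE negb_or eq_sym; case: (v =P x) => [vx|_] /=.
  have vl : v \notin l by rewrite vx.
  by rewrite -vx vp (negbTE vl) subn0 addKn.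
case: (boolP (v \in l)) => vl; last by rewrite !subn0.
have : 0 < count (fun x => x \notin p) l by rewrite -has_count; apply/hasP; exists v.
by move=> c0; rewrite addnBA.
Qed.

Lemma residual_gt0 p u v : v \notin p -> u \in nbrs P v -> 0 < residual p u.
Proof.
move=> vp uv; rewrite /residual -has_count; apply/hasP; exists v => //.
by rewrite mem_undup mem_nbrs P_sym -mem_nbrs.
Qed.

Lemma wp_peel s o : setup s n k P -> var s HEAD = 0 -> queued s o -> uniq o ->
  (forall u, (u \in o) = (u < n) && (size (undup (nbrs P u)) < k)) ->
  (forall u, u < n -> arr s DEGS u = size (undup (nbrs P u))) ->
  (forall u, arr s PEELED u = 0) ->
  wp W (While (Lt HEAD TAIL) peel_next) s (\sum_(0 <= u < n) weight k P u).+1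
   (fun s' => exists o, [/\ queued s' o /\ var s' HEAD = size o, uniq o,
      forall u, (u \in o) = (u < n) && (residual o u < k) &
      forall i, i < size o -> residual (take i o) (nth 0 o i) < k]).
Proof.
move=> su H0 q0 u0 m0 d0 p0.
(* The first [h] queue entries are peeled and only the others still hold budget. The last clause,
   that each vertex had fewer than [k] remaining neighbours when peeled, is what the coloring
   needs. *)
pose J T s' := exists (o : seq nat) (h : nat),
  [/\ T = \sum_(0 <= u < n | u \notin take h o) weight k P u,
  queued s' o /\ var s' HEAD = h, h <= size o, uniq o &
  [/\ forall u, (u \in o) = (u < n) && (residual (take h o) u < k),
   forall u, u < n -> arr s' DEGS u = residual (take h o) u,
   forall u, arr s' PEELED u = 0 \/ (arr s' PEELED u).-1 \in take h o &
   forall i, i < h -> residual (take i o) (nth 0 o i) < k]].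
have r0 u : residual [::] u = size (undup (nbrs P u)).
  by rewrite /residual (eq_count (a2 := predT)) ?count_predT.
have J0 : J (\sum_(0 <= u < n) weight k P u) s.
  exists o, 0; rewrite take0; split=> //.
  by split=> [u|u un|u|//]; [rewrite m0 r0 | rewrite r0 d0 | left].
apply: wp_conseq (wp_while J0 _) => //.
  move=> s' _ [fr nb [T [o1 [h [_ [[t q] hE] ho uo [mo dE pE bE]]]]]].
  have hs : h = size o1.
    by apply/eqP; rewrite eqn_leq ho leqNgt; move: nb; rewrite /= t hE.
  exists o1; rewrite hs take_size in mo bE *; split=> //.
  by rewrite hE hs.
move=> T s1 fr [o1 [h [-> [q1 hE] ho uo [mo dE pE bE]]]] /=.
have {fr}su1 := setup_frame fr isT isT su.
have [_ one1 _ _ _] := su1; have [t1 e1] := q1.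
rewrite hE t1 => h_lt; set v := nth 0 o1 h; set p := take h o1 in mo dE pE *.
have vo : v \in o1 by apply: mem_nth.
have vn : v < n by move: vo; rewrite mo => /andP[].
have vp : v \notin p.
  move: uo; rewrite -(cat_take_drop h o1) (drop_nth 0) // cat_uniq /= negb_or.
  by case/and3P=> _ /andP[].
exists (weight k P v).-1, (\sum_(0 <= u < n | u \notin rcons p v) weight k P u); split; last first.
  rewrite [X in _ < X]big_mkcond (bigD1_seq v) ?iota_uniq ?mem_index_iota //= vp -big_mkcondr.
  rewrite (eq_bigl (fun u => (u != v) && (u \notin p))) ?ltn_add2r ?ltn_predL ?weight_gt0 //.
  by move=> u; rewrite mem_rcons inE negb_or.
have -> : (weight k P v).-1 = 2 + ((size (nbrs P v) * 13 + 2) + (15 + 4 * k)).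
  by rewrite /weight; clear; lia.
apply: wp_seq; apply: (wp_block (p := Seq _ _)).
  by rewrite /= one1 hE e1 // -/v; clear -vn nW; split; lia.
set s2 := step _ _.
have st2 : var s2 STAMP = v.+1 by rewrite /= one1 hE e1 // addn1.
have v2 : var s2 VV = v by rewrite /= hE e1.
have su2 : setup s2 n k P by [].
have {}hE : var s2 HEAD = h by [].
(* Midway through the list of [v], precisely the neighbours in [d] have been decremented; [x]
   collects the vertices queued meanwhile. *)
pose I (d : seq nat) s' := exists x : seq nat, let o2 := o1 ++ x in
  [/\ queued s' o2, uniq o2,
    forall u, u < n -> arr s' DEGS u = residual p u - (u \in d),
    forall u, (u \in o2) = (u < n) && (residual p u - (u \in d) < k) &
    (forall u, (arr s' PEELED u == v.+1) = (u \in d)) /\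
    (forall u, arr s' PEELED u = 0 \/ (arr s' PEELED u).-1 \in v :: p)].
have I0 : I [::] s2.
  exists [::]; rewrite /= cats0; split=> //.
  - by move=> u un; rewrite subn0; apply: dE.
  - by move=> u; rewrite subn0; apply: mo.
  split=> u; last by case: (pE u); [left | right; rewrite inE orbC; apply/orP; left].
  apply/negbTE/eqP=> pu; case: (pE u) => [p0u|]; first by rewrite p0u in pu.
  by move: pu => /= ->; apply/negP.
move: s2 st2 v2 su2 hE I0 => s2 st2 v2 su2 hE I0.
have pn u : u \in v :: p -> u < n.
  by rewrite inE => /orP[/eqP -> // | /mem_take]; rewrite mo => /andP[].
have resn u : residual p u <= n.
  apply: leq_trans (count_size _ _) _.
  rewrite -(size_iota 0 n); apply: uniq_leq_size (undup_uniq _) _ => x.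
  by rewrite mem_undup mem_iota => /nbrs_lt.
apply: wp_seq.
apply: wp_conseq (leqnn _) _ (wp_scan_nbrs (I := I) _ _ su2 v2 _ _ I0 _) => //; last first.
  move=> d s3 fr3 [_ one3 k3 _ _] [x [q3 u3 D3 m3 [P3 pp3]]] ul.
  set u := var s3 UU in ul *.
  have st3 : var s3 STAMP = v.+1 by rewrite (proj1 fr3).
  have eE : (arr s3 PEELED u == v.+1) = (u \in d) by apply: P3.
  have un := nbrs_lt ul; have {}resn := resn u.
  have pW : arr s3 PEELED u <= W.
    by case: (pp3 u) => [->|/pn] //; clear -nW; lia.
  have qn : size (o1 ++ x) <= n.
    rewrite -(size_iota 0 n); apply: uniq_leq_size u3 _ => y.
    by rewrite mem_iota m3 => /andP[].
  have r_gt0 := residual_gt0 vp ul.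
  have [t3 e3] := q3.
  apply: wp_block_le => //.
    rewrite /= -/u st3 eE; split=> //; case: ifPn => // ud /=.
    rewrite one3 k3 t3 -/u D3 // (negbTE ud) subn0.
    do ! split=> //.
    + by clear -resn nW; lia.
    + by clear -resn nW; lia.
    + by case: ifP => //= _; rewrite ?t3 ?one3; clear -qn nW; lia.
  rewrite /= -/u st3 eE; case: ifPn => ud /=.
    have md y : (y \in u :: d) = (y \in d) by rewrite inE; case: eqP => // ->.
    exists x; split=> //; last by split=> // y; rewrite md; apply: P3.
      by move=> y yn; rewrite md; apply: D3.
    by move=> y; rewrite md; apply: m3.
  rewrite one3 k3 -/u D3 // (negbTE ud) subn0.
  have dE' y : y < n -> (if y == u then residual p u - 1 else arr s3 DEGS y) =
      residual p y - (y \in u :: d).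
    by move=> yn; rewrite inE; case: eqP => [->|_] //=; rewrite D3.
  have pE1 y : ((if y == u then v.+1 else arr s3 PEELED y) == v.+1) = (y \in u :: d).
    by rewrite inE -P3; case: (y == u) => //=; rewrite eqxx.
  have pE2 y : (if y == u then v.+1 else arr s3 PEELED y) = 0 \/
      (if y == u then v.+1 else arr s3 PEELED y).-1 \in v :: p.
    by case: eqP => // _; right; rewrite inE eqxx.
  have uq : (u \in o1 ++ x) = (residual p u < k) by rewrite m3 un (negbTE ud) subn0.
  case: ifPn => rk.
    have un' : u \notin o1 ++ x by rewrite uq (eqP rk) ltnn.
    exists (rcons x u); rewrite -rcons_cat; split=> //.
    + by apply: (queued_rcons (s := s3)) => //= [|i]; rewrite t3 ?one3 ?addn1.
    + by rewrite rcons_uniq un'.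
    + move=> y; rewrite mem_rcons !inE m3; case: eqP => //= ->.
      by rewrite un (eqP rk); clear -r_gt0 rk; lia.
  exists x; split=> // y; rewrite m3 inE; case: eqP => //= ->.
  by rewrite un (negbTE ud) /=; clear -r_gt0 rk; lia.
move=> s3 fr3 [x [q3 u3 D3 m3 [_ pp3]]].
have [_ one3 _ _ _] := setup_frame fr3 isT isT su2.
have h3 : var s3 HEAD = h by rewrite (proj1 fr3).
have qn : size (o1 ++ x) <= n.
  rewrite -(size_iota 0 n); apply: uniq_leq_size u3 _ => y.
  by rewrite mem_iota m3 => /andP[].
apply: wp_block_le => //.
  by rewrite /= h3 one3; move: qn; rewrite size_cat; clear -nW h_lt; lia.
have rE u : residual p u - (u \in rev (nbrs P v)) = residual (rcons p v) u.
  by rewrite residual_rcons // mem_rev.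
have tk : take h.+1 (o1 ++ x) = rcons p v.
  by rewrite takel_cat // (take_nth 0).
exists (o1 ++ x), h.+1; rewrite tk; split=> //.
- by split=> //; rewrite /= h3 one3 addn1.
- by rewrite size_cat; clear -h_lt; lia.
split.
- by move=> u; rewrite m3 rE.
- by move=> u un; rewrite -rE; apply: D3.
- by move=> u; case: (pp3 u); [left | right; rewrite mem_rcons].
- move=> i; rewrite ltnS leq_eqVlt => ih.
  have io : i < size o1 by clear -ih h_lt; lia.
  rewrite nth_cat io take_cat io; case/orP: ih => [/eqP ->|/bE //].
  by move: vo; rewrite mo => /andP[].
Qed.

(** * Greedy coloring in the reverse peeling order *)

Hypothesis P_irr : forall u : nat, (u, u) \notin P.

(** An uncolored neighbour has color 0 and marks only [USED[0]], which the search, starting at color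
    1, never reads. *)
Definition mark_colors := scan (Seq (Assign RR (Read CLR UU)) (Store USED RR STAMP)).

Definition skip_used :=
  Seq (Assign RR (Read USED COL)) (If (Eq RR STAMP) (Assign COL (Add COL ONE)) Skip).

(** The search is unrolled, as [k] is a constant of the program. Once [COL] is a free color, the
    remaining copies leave it there. *)
Definition pick_color j := iter j (Seq skip_used) Skip.

Definition color_next j :=
  Seq (Seq (Assign HEAD (Defs.Sub HEAD ONE)) (Seq (Assign VV (Read QUEUE HEAD))
      (Seq (Assign STAMP (Add VV ONE)) (Assign COL (Var ONE)))))
 (Seq mark_colors (Seq (pick_color j) (Store CLR VV COL))).

Lemma pick_color_written j :
  {subset written_vars (pick_color j) <= [:: RR; COL]} /\
  written_arrs (pick_color j) = [::].
Proof.
elim: j => [|j [IHv IHa]] //; split; last exact: IHa.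
by move=> x; rewrite /= !inE => /or3P[-> | -> | /IHv]; rewrite ?orbT // !inE.
Qed.

(** Unrolling further writes to no new register, so frame conditions for a variable [j] reduce to
    the concrete case [j = 1]. *)
Lemma frame_color_next j s s' : frame (color_next j) s s' -> frame (color_next 1) s s'.
Proof.
have [pv pa] := pick_color_written j.
apply: frame_sub => x; rewrite /= ?pa //.
rewrite !inE mem_cat in_nil orbF => /or4P[->|->|->|]; rewrite ?orbT //.
by case/or4P=> [->|->|->|/or3P[->|->|/pv]]; rewrite ?inE ?orbT // => /orP[]->; rewrite ?orbT.
Qed.

Lemma wp_pick_color j c0 s st : var s ONE = 1 -> var s STAMP = st ->
  var s COL = c0 -> 0 < c0 -> c0 + j <= W -> (forall c, arr s USED c <= W) ->
  (forall c, 0 < c < c0 -> arr s USED c = st) ->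
  wp W (pick_color j) s (j * 3).+1 (fun s' => exists c,
   [/\ var s' COL = c, 0 < c, forall c', 0 < c' < c -> arr s USED c' = st &
       c = c0 + j \/ c < c0 + j /\ arr s USED c <> st]).
Proof.
elim: j c0 s => [|j IH] c0 s one stE cE c0_gt0 cW uW ux.
  by apply: (wp_block (p := Skip)) => //; exists c0; rewrite addn0; split=> //; left.
rewrite -[(j.+1 * 3).+1]/(3 + (j * 3).+1); apply: wp_seq.
apply: (wp_block (p := skip_used)).
  rewrite /= cE stE; split=> //; case: ifP => //= _.
  by rewrite ?cE one; clear -cW; lia.
rewrite /= cE stE; case: (arr s USED c0 =P st) => uc.
  rewrite ?cE one addn1 -addSnnS; apply: (IH c0.+1) => //=.
    by clear -cW; lia.
  move=> c /andP[c_gt0]; rewrite ltnS leq_eqVlt => /orP[/eqP -> //|cc].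
  by apply: ux; rewrite c_gt0.
apply: wp_conseq (IH c0 _ _ _ _ _ _ _ _) => //=; last by clear -cW; lia.
move=> s' _ [c [cE' c_gt0 below ends]]; exists c; split=> //; right.
case: ends => [ce|[lt_c un]]; last by split=> //; clear -lt_c; lia.
split; first by rewrite ce; clear; lia.
(* Had the rest of the search run past its last color with [j > 0], the color [c0] would be marked,
   but it is free. *)
rewrite ce; case: (posnP j) => [->|j_gt0]; first by rewrite addn0.
by case: uc; apply: below; rewrite c0_gt0 ce; clear -j_gt0; lia.
Qed.

Lemma wp_colors s o : setup s n k P -> queued s o -> var s HEAD = size o -> uniq o ->
  (forall u, (u \in o) = (u < n)) ->
  (forall i, i < size o -> residual (take i o) (nth 0 o i) < k) ->
  (forall u, arr s CLR u = 0) -> (forall c, arr s USED c = 0) ->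
  wp W (While (Lt ZERO HEAD) (color_next k)) s (\sum_(0 <= u < n) weight k P u).+1
   (fun s' => (forall u, u < n -> 0 < arr s' CLR u <= k) /\
      forall u v, (u, v) \in P -> arr s' CLR u != arr s' CLR v).
Proof.
move=> su q0 H0 uo mo back c0 us0.
(* The vertices of [drop h o] are colored, all others still have color 0. Stamps come from colored
   vertices only, so the stamp of the next vertex is fresh. *)
pose J T s' := exists h : nat, [/\ T = \sum_(u <- take h o) weight k P u, h <= size o,
  var s' HEAD = h, forall c, arr s' USED c = 0 \/ (arr s' USED c).-1 \in drop h o &
  [/\ forall u, u \in drop h o -> 0 < arr s' CLR u <= k,
      forall u, u \notin drop h o -> arr s' CLR u = 0 &
      forall u v, u \in drop h o -> v \in drop h o -> (u, v) \in P ->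
        arr s' CLR u != arr s' CLR v]].
have po : perm_eq o (index_iota 0 n).
  by apply: uniq_perm; rewrite ?iota_uniq // => u; rewrite mo mem_index_iota.
have on : size o = n by rewrite (perm_size po) size_iota subn0.
have J0 : J (\sum_(0 <= u < n) weight k P u) s.
  exists (size o); rewrite take_size drop_size; split=> //; last by left.
  by rewrite (perm_big _ po).
apply: wp_conseq (wp_while J0 _) => //.
  move=> s' _ [fr nb [T [h [_ ho hE _ [cE _ pE]]]]].
  have [z' _ _ _ _] := setup_frame (frame_color_next fr) isT isT su.
  have h0 : h = 0 by move: nb; rewrite /= z' hE; case: (h).
  rewrite h0 drop0 in cE pE; split=> [u un | u v uv]; first by apply: cE; rewrite mo.
  by have /andP[un vn] := P_lt uv; apply: pE; rewrite ?mo.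
move=> T s1 /frame_color_next fr [h [-> ho hE usE [cE cN pE]]] /=.
have su1 := setup_frame fr isT isT su.
have [z1 one1 _ _ _] := su1; rewrite z1 hE => h_gt0.
have [q1 e1] : queued s1 o.
  by case: q0 => t0 e0; split=> [|i io]; rewrite ?(proj1 fr) ?(proj2 fr) ?e0.
case: h h_gt0 ho hE usE cE cN pE => // h _ ho hE usE cE cN pE.
set v := nth 0 o h.
have vn : v < n by rewrite -mo mem_nth.
have dh : drop h o = v :: drop h.+1 o by apply: drop_nth.
have uo' : uniq (drop h o) by apply: drop_uniq.
have vd : v \notin drop h.+1 o by move: uo'; rewrite dh => /andP[].
exists (weight k P v).-1, (\sum_(u <- take h o) weight k P u); split; last first.
  rewrite (take_nth 0 ho) -cats1 big_cat big_seq1 /= -/v addnC ltn_add2l ltn_predL.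
  exact: weight_gt0.
have -> : (weight k P v).-1 = 4 + ((size (nbrs P v) * 13 + 2) + ((k * 3).+1 + (12 + k))).
  by rewrite /weight; clear; lia.
apply: wp_seq; apply: (wp_block (p := Seq _ _)).
  rewrite /= hE one1 subn1 /= e1 // -/v addn1; move: ho; rewrite on => ho.
  by clear -nW kW vn ho; do ! split; lia.
set s2 := step _ _.
have st2 : var s2 STAMP = v.+1 by rewrite /= one1 hE subn1 /= e1 // addn1.
have v2 : var s2 VV = v by rewrite /= hE one1 subn1 /= e1.
have su2 : setup s2 n k P by [].
have h2 : var s2 HEAD = h by rewrite /= hE one1 subn1.
have c2 : var s2 COL = 1 by [].
pose I (d : seq nat) s' :=
  (forall c, (arr s' USED c == v.+1) = (c \in [seq arr s1 CLR u | u <- d])) /\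
  (forall c, arr s' USED c = 0 \/ (arr s' USED c).-1 \in drop h o).
have I0 : I [::] s2.
  split=> c; last by rewrite dh; case: (usE c); [left | right; rewrite inE; apply/orP; right].
  apply/negbTE/eqP=> uc; case: (usE c) => [u0|]; first by rewrite u0 in uc.
  by move: uc => /= ->; apply/negP.
have r2 u : arr s2 CLR u = arr s1 CLR u by [].
move: s2 st2 v2 su2 h2 c2 I0 r2 => s2 st2 v2 su2 h2 c2 I0 r2.
apply: wp_seq.
apply: wp_conseq (leqnn _) _ (wp_scan_nbrs (I := I) _ _ su2 v2 _ _ I0 _) => //; last first.
  move=> d s3 fr3 _ [us3 le3] ul; set u := var s3 UU in ul *.
  have st3 : var s3 STAMP = v.+1 by rewrite (proj1 fr3).
  have r3 x : arr s3 CLR x = arr s1 CLR x by rewrite (proj2 fr3).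
  apply: wp_block_le => //=.
    split=> //; rewrite r3; case: (boolP (u \in drop h.+1 o)) => [/cE/andP[_ ck]|/cN -> //].
    exact: leq_trans ck (ltnW kW).
  rewrite -/u st3 r3; split=> c /=.
    by rewrite inE -us3; case: (c == _) => //; rewrite eqxx.
  by case: (c == _) => //; right; rewrite /= dh mem_head.
move=> s3 fr3 [us3 le3].
have st3 : var s3 STAMP = v.+1 by rewrite (proj1 fr3).
have r3 x : arr s3 CLR x = arr s1 CLR x by rewrite (proj2 fr3).
have [_ one3 _ _ _] := setup_frame fr3 isT isT su2.
have h3 : var s3 HEAD = h by rewrite (proj1 fr3).
have v3 : var s3 VV = v by rewrite (proj1 fr3).
have c3 : var s3 COL = 1 by rewrite (proj1 fr3).
apply: wp_seq.
apply: wp_conseq (leqnn _) _ (wp_pick_color one3 st3 c3 _ _ _ _) => //; last first.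
- by move=> c; clear; lia.
- move=> c; case: (le3 c) => [-> //|/mem_drop]; rewrite mo.
  by clear -nW; lia.
move=> s4 fr4 [c [c4 c_gt0 below ends]].
have [pv pa] := pick_color_written k.
have fv x : x \notin [:: RR; COL] -> var s4 x = var s3 x.
  by move=> xn; rewrite (proj1 fr4) //; apply: contra xn => /pv.
have fa a i : arr s4 a i = arr s3 a i by rewrite (proj2 fr4) // pa.
have {ends} [ck cu] : c <= k /\ arr s3 USED c <> v.+1.
  case: ends => [ck|[ck]]; last by rewrite add1n in ck.
  (* If the colors 1 to [k] were all marked, they would come from [k] distinct colored neighbours of
     [v]. These lie outside [take h o], where the peeling order leaves fewer than [k]. *)
  pose L := [seq u <- undup (nbrs P v) | u \notin take h o].
  have : size (iota 1 k) <= size [seq arr s1 CLR u | u <- L].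
    apply: uniq_leq_size (iota_uniq _ _) _ => x; rewrite mem_iota -ck => x1c.
    have /eqP := below _ x1c; rewrite us3 => /mapP[u].
    rewrite mem_rev => uv xE; apply/mapP; exists u => //.
    rewrite mem_filter mem_undup uv andbT.
    have ud : u \in drop h.+1 o.
      by apply/negPn/negP=> /cN u0; rewrite xE u0 in x1c.
    have ud' : u \in drop h o by rewrite dh inE ud orbT.
    apply/negP=> ut; move: uo; rewrite -(cat_take_drop h o) cat_uniq.
    by case/and3P=> _ /hasPn /(_ _ ud') /negP.
  rewrite size_iota size_map size_filter => le_k.
  by have := back h ho; rewrite ltnNge le_k.
have cnb w : (v, w) \in P -> arr s1 CLR w != c.
  rewrite -mem_nbrs => wv; apply/eqP=> wc; case: cu; apply/eqP.
  by rewrite us3 -wc map_f // mem_rev.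
apply: wp_block_le => //.
have v4 : var s4 VV = v by rewrite fv.
have h4 : var s4 HEAD = h by rewrite fv.
exists h; rewrite /= v4 h4 c4; split=> //.
- exact: ltnW.
- by move=> x; rewrite fa.
have clr u : (if u == v then c else arr s4 CLR u) = if u == v then c else arr s1 CLR u.
  by rewrite fa r3.
split.
- move=> u; rewrite dh inE clr; case: eqP => [_|_ /cE //] _.
  by rewrite c_gt0.
- by move=> u; rewrite dh inE clr; case: eqP => //= _ /cN.
- move=> u w; rewrite dh !inE !clr.
  case: eqP => [->|_]; case: eqP => [->|_] //=.
  + by rewrite (negbTE (P_irr v)).
  + by move=> _ _ /cnb; rewrite eq_sym.
  + by move=> _ _; rewrite P_sym => /cnb.
  + exact: pE.
Qed.

End Phases.

(** * The program and its correctness *)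

(** Each pair enters the list of one vertex only, so scanning every list once takes linear time in
    total. *)
Lemma sum_nbrs n P : \sum_(0 <= u < n) size (nbrs P u) <= size P.
Proof.
elim: P => [|p P IH]; first by rewrite big1.
have -> : \sum_(0 <= u < n) size (nbrs (p :: P) u) =
    \sum_(0 <= u < n) (p.1 == u) + \sum_(0 <= u < n) size (nbrs P u).
  by rewrite -big_split; apply: eq_bigr => u _; rewrite /nbrs /=; case: (p.1 == u).
rewrite /= -add1n; apply: leq_add IH.
rewrite (eq_bigr (fun u => if p.1 == u then 1 else 0)); last by move=> u _; case: eqP.
rewrite -big_mkcond sum1_count; under eq_count do rewrite eq_sym.
by rewrite count_uniq_mem ?iota_uniq // leq_b1.
Qed.

(** Here 78 is 13 steps for each of at most six list entries per hyperedge. *)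
Lemma sum_weight n k P m : size P <= 6 * m ->
  \sum_(0 <= u < n) weight k P u <= 78 * m + n * (20 + 4 * k).
Proof.
move=> Pm; rewrite big_split /= -big_distrl /= sum_nat_const_nat subn0.
rewrite leq_add2r -[78]/(13 * 6) -mulnA mulnC leq_mul2l.
exact: leq_trans (sum_nbrs n P) Pm.
Qed.

Definition init_vars k :=
  Seq (Assign ONE (Const 1)) (Seq (Assign KK (Const k)) (Seq (Assign THREE (Const 3))
  (Seq (Assign NN (Read IN ZERO)) (Seq (Assign MM (Read IN ONE)) (Assign POS (Const 2)))))).

Definition program k :=
  Seq (init_vars k)
 (Seq (While (Lt EE MM) read_edge)
 (Seq (While (Lt VV NN) count_degree)
 (Seq (While (Lt HEAD TAIL) peel_next)
      (While (Lt ZERO HEAD) (color_next k))))).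

(** With [N = n + m + 2 >= 2], the power [N ^ 4 >= 8 * N] covers the input-dependent quantities, and
    [N ^ k >= 2 ^ k > k] the constant [k]. *)
Lemma word_size_bounds k n m (W := (n + m).+2 ^ (k + 5)) :
  [/\ 6 * m + 2 <= W, n.+1 < W & k < W].
Proof.
have N2 : 2 <= (n + m).+2 by [].
have e4 : 8 * (n + m).+2 <= (n + m).+2 ^ 4.
  rewrite (expnS _ 3) mulnC; apply: leq_mul => //.
  by rewrite -[8]/(2 ^ 3) leq_exp2r.
have W4 : (n + m).+2 ^ 4 <= W by rewrite leq_exp2l // addnC.
have Wk : k < W.
  apply: leq_trans (ltn_expl k (isT : 1 < 2)) _.
  apply: leq_trans (_ : (n + m).+2 ^ k <= _); first by case: (k) => // j; rewrite leq_exp2r.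
  by rewrite leq_exp2l // leq_addr.
by split=> //; clear -e4 W4; lia.
Qed.

(** * From the encoded hyperedges to the shadow graph *)

Section Correctness.
Variables (k n : nat) (H : {set {set 'I_n}}) (es : seq (seq 'I_n)).
Hypothesis k_ge3 : 3 <= k.
Hypothesis H_size : forall e : {set 'I_n}, e \in H -> #|e| = 2 \/ #|e| = 3.
Hypothesis H_free : ~ contains_berge H (path_graph k).
Hypothesis H_es : represents es H.

Let ns := [seq [seq val x | x <- e] | e <- es].

Lemma card_represented : #|H| = size es.
Proof.
have [_ us <-] := H_es.
by rewrite cardsE (card_uniqP us) size_map.
Qed.

Lemma mem_represented e : e \in es -> [set x in e] \in H.
Proof. by have [_ _ <-] := H_es => ees; rewrite inE map_f. Qed.

Lemma represented_edge e : e \in ns ->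
  [/\ (size e == 2) || (size e == 3), uniq e & {in e, forall x, x < n}].
Proof.
case/mapP=> e' ees ->; have [/allP ue _ _] := H_es; have {}ue := ue _ ees.
rewrite size_map (map_inj_uniq val_inj) ue; split=> //.
  have := H_size (mem_represented ees); rewrite cardsE (card_uniqP ue).
  by case=> ->.
by move=> _ /mapP[x _ ->]; apply: ltn_ord.
Qed.

Lemma joined_shadow (u v : 'I_n) : has (joined u v) ns = shadow H u v.
Proof.
have [_ _ HE] := H_es.
apply/hasP/andP => [[_ /mapP[e ees ->]] /and3P[ue ve uv] | [uv /existsP[X]]].
  split=> //; apply/existsP; exists [set x in e].
  by rewrite mem_represented // !inE -!(mem_map val_inj) ue ve.
rewrite -{1}HE inE => /and3P[/mapP[e ees ->]]; rewrite !inE => ue ve.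
exists [seq val x | x <- e]; first exact: map_f.
by rewrite /joined !(mem_map val_inj) ue ve.
Qed.

Variable P : seq (nat * nat).
Hypothesis P_joined : forall u v : nat, ((u, v) \in P) = has (joined u v) ns.

Lemma pairs_sym (u v : nat) : ((u, v) \in P) = ((v, u) \in P).
Proof. by rewrite !P_joined; apply: eq_has => e; rewrite /joined andbCA eq_sym. Qed.

Lemma pairs_irr (u : nat) : (u, u) \notin P.
Proof. by rewrite P_joined; apply/hasPn=> e _; rewrite /joined eqxx !andbF. Qed.

Lemma pairs_lt (u v : nat) : (u, v) \in P -> (u < n) && (v < n).
Proof.
rewrite P_joined => /hasP[e /represented_edge[_ _ en]] /and3P[ue ve _].
by rewrite !en.
Qed.

(** Vertices that are never queued keep at least [k] neighbours among themselves, so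
    [not_all_large_degree] excludes them. *)
Lemma peeled_all (o : seq nat) :
  (forall u, (u \in o) = (u < n) && (residual P o u < k)) ->
  forall u, (u \in o) = (u < n).
Proof.
move=> mo u; rewrite mo; case: (ltnP u n) => //= un; apply/negPn/negP => uk.
pose S := [set x : 'I_n | val x \notin o].
have S0 : S != set0.
  by apply/set0Pn; exists (Ordinal un); rewrite inE /= mo un.
have H3 e : e \in H -> #|e| <= 3 by move/H_size=> [] ->.
apply: (not_all_large_degree H3 k_ge3 S0 H_free) => v; rewrite inE mo ltn_ord /= -leqNgt.
move=> le_k; apply: leq_trans le_k _.
rewrite /residual -size_filter cardE -(size_map val).
apply: uniq_leq_size => [|x]; first by rewrite filter_uniq ?undup_uniq.
rewrite mem_filter mem_undup mem_nbrs => /andP[xo vx].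
have /andP[_ xn] := pairs_lt vx.
apply/mapP; exists (Ordinal xn) => //.
by rewrite mem_enum !inE /= xo -joined_shadow -P_joined.
Qed.

End Correctness.

Lemma wp_program k n (H : {set {set 'I_n}}) (es : seq (seq 'I_n)) : 3 <= k ->
  (forall e : {set 'I_n}, e \in H -> #|e| = 2 \/ #|e| = 3) ->
  ~ contains_berge H (path_graph k) -> represents es H ->
  wp ((n + #|H|).+2 ^ (k + 5)) (program k) (init_state (encode es))
    ((400 + 12 * k) * (n + #|H|).+1)
    (fun s => (forall u, u < n -> 0 < arr s CLR u <= k) /\
       forall u v : 'I_n, shadow H u v -> arr s CLR u != arr s CLR v).
Proof.
move=> k_ge3 H_size H_free H_es.
have [] := word_size_bounds k n #|H|.
set W := _ ^ _; set m := #|H| => mW nW kW.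
have mE : m = size es := card_represented H_es.
pose ns := [seq [seq val x | x <- e] | e <- es].
have nsm : size ns = m by rewrite size_map.
pose B := (78 * m + n * (20 + 4 * k)).+1.
(* The summands are the six initial assignments, the reading loop at 41 steps per hyperedge, and [B]
   for each of the three loops over the vertices. *)
have TE : 6 + ((41 * m).+1 + (B + (B + B))) <= (400 + 12 * k) * (n + m).+1.
  by rewrite /B; clear; nia.
apply: wp_conseq TE (fun _ _ h => h) _.
apply: wp_seq; apply: (wp_block (p := init_vars k)).
  by rewrite /= -mE; clear -nW mW kW k_ge3; do ! split; lia.
set s1 := step _ _.
have [one1 three1 k1 n1] : [/\ var s1 ONE = 1, var s1 THREE = 3, var s1 KK = k
  & var s1 NN = n] by [].
have [z1 E1 m1 p1] : [/\ var s1 ZERO = 0, var s1 EE = 0, var s1 MM = size ns & var s1 POS = 2].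
  by split=> //; rewrite nsm mE.
have [v1 h1 q1] : [/\ var s1 VV = 0, var s1 HEAD = 0 & queued s1 [::]] by [].
have ad1 : adjacency s1 [::] by [].
have [a1 a5 a8 a9] : [/\ forall i, arr s1 CLR i = 0, forall i, arr s1 SEEN i = 0,
  forall i, arr s1 PEELED i = 0 & forall i, arr s1 USED i = 0] by [].
have in1 i : arr s1 IN (2 + i) = nth 0 (flatten [seq size e :: e | e <- ns]) i.
  rewrite /= /ns -map_comp; congr (nth 0 (flatten _) i); apply: eq_map => e /=.
  by rewrite size_map.
move: s1 one1 three1 k1 n1 z1 E1 m1 p1 v1 h1 q1 ad1 a1 a5 a8 a9 in1.
move=> s1 one1 three1 k1 n1 z1 E1 m1 p1 v1 h1 q1 ad1 a1 a5 a8 a9 in1.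
apply: wp_seq; apply: wp_conseq (wp_read_edges (ns := ns) _ one1 three1 E1 m1 p1 in1 ad1 _);
  rewrite ?nsm //; last first.
  move=> e /(represented_edge H_size H_es)[se ue en]; split=> // x /en xn.
  by clear -xn nW; lia.
move=> s2 fr2 [P [ad2 sP mP]].
have P_sym := pairs_sym mP; have P_irr := pairs_irr mP.
have P_lt := pairs_lt H_size H_es mP.
have PW : size P <= W by clear -sP mW; lia.
have su2 : setup s2 n k P by split=> //; rewrite (proj1 fr2).
have sW := sum_weight n k sP.
apply: wp_seq; apply: wp_conseq (wp_degrees PW nW kW P_lt su2 _ _ _) => //; last first.
- by move=> u; rewrite (proj2 fr2).
- by split=> //; rewrite (proj1 fr2) //; case: q1.
- by rewrite (proj1 fr2).
move=> s3 fr3 [o3 [q3 u3 m3 d3]].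
have su3 := setup_frame fr3 isT isT su2.
apply: wp_seq; apply: wp_conseq (wp_peel PW nW P_lt P_sym su3 _ q3 u3 m3 d3 _) => //; last first.
- by move=> u; rewrite (proj2 fr3) // (proj2 fr2).
- by rewrite (proj1 fr3) // (proj1 fr2).
move=> s4 fr4 [o [[q4 h4] u4 m4 b4]].
have {}m4 := peeled_all k_ge3 H_size H_free H_es mP m4.
have su4 := setup_frame fr4 isT isT su3.
apply: wp_conseq (wp_colors PW nW kW P_lt P_sym P_irr su4 q4 h4 u4 m4 b4 _ _) => //; last first.
- by move=> u; rewrite (proj2 fr4) // (proj2 fr3) // (proj2 fr2).
- by move=> u; rewrite (proj2 fr4) // (proj2 fr3) // (proj2 fr2).
move=> s5 _ [c5 p5]; split=> // u v uv; apply: p5.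
by rewrite mP (joined_shadow H_es).
Qed.

Theorem theorem5p3 (k : nat) (hk : 3 <= k) :
  exists (p : cmd) (b C : nat),
    forall (n : nat) (H : {set {set 'I_n}}) (es : seq (seq 'I_n)),
      (forall e : {set 'I_n}, e \in H -> #|e| = 2 \/ #|e| = 3) ->
      ~ contains_berge H (path_graph k) ->
      represents es H ->
      exists (t : nat) (s : state),
        [/\ exec ((n + #|H|).+2 ^ b) p (init_state (encode es)) t s,
            t <= C * (n + #|H|).+1,
            strong_coloring H (@output n s)
          & num_colors (@output n s) <= k].
Proof.
exists (program k), (k + 5), (400 + 12 * k) => n H es H_size H_free H_es.
have [t [s [ex le_t [rng proper]]]] := wp_program hk H_size H_free H_es.
exists t, s; split=> //.
- move=> e eH u v ue ve uv; apply/eqP/negPn/negP => neq.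
  have : shadow H u v.
    by rewrite /shadow neq; apply/existsP; exists e; rewrite eH ue ve.
  by move/proper; rewrite -[arr s 1 u]/(output s u) uv eqxx.
- rewrite /num_colors -[leqRHS](size_iota 1).
  apply: uniq_leq_size (undup_uniq _) _ => c; rewrite mem_undup => /codomP[u ->].
  by rewrite mem_iota add1n ltnS; apply: rng.
Qed.
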